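(* Let $n\geq 5$ be an integer. Every simple arrangement of $n$ planes in $\mathbb{R}^3$ has at least $\frac{n(n-2)+6}{3}$ external facets.
   Context: An arrangement $\mathcal{A}_{d,n}$ of $n$ (distinct) hyperplanes (affine, in $\mathbb{R}^d$) is called simple if $n\geq d+1$ and any $d$ of the hyperplanes intersect at a distinct point (i.e. any $d$ hyperplanes meet in exactly one point, and different choices of $d$ hyperplanes give different points). For $d=3$ this means $n\ge 4$, any three planes meet in exactly one point, and no four planes share a point. The cells of the arrangement are the closures of the connected components of the complement of the union of the hyperplanes. For $k=0,\dots,d-1$, the $k$-faces of the arrangement are the $k$-faces of its cells (each cell being a polyhedron). A facet of the arrangement is a $(d-1)$-face; for $d=3$ the facets are the (bounded or unbounded) 2-dimensional polygonal regions into which each plane is divided by the other planes. A facet is called external if it belongs to exactly one bounded cell; equivalently, it is a bounded facet which belongs to an unbounded cell. *)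

(* Defs.v *)
From HB Require Import structures.
From mathcomp Require Import all_boot all_order all_algebra finmap.
From mathcomp Require Import all_classical all_reals all_analysis.

Set Implicit Arguments.
Unset Strict Implicit.
Unset Printing Implicit Defensive.

Import Order.TTheory GRing.Theory Num.Theory.
Import numFieldNormedType.Exports.

Local Open Scope classical_set_scope.
Local Open Scope ring_scope.

Definition dotp (R : realType) (d : nat) (u v : 'rV[R]_d) : R :=
  \sum_(i < d) u 0 i * v 0 i.

Definition is_hyperplane (R : realType) (d : nat) (P : set 'rV[R]_d) : Prop :=
  exists a : 'rV[R]_d, exists b : R,
    a != 0 /\ P = [set x : 'rV[R]_d | dotp a x = b].

(* An arrangement of n hyperplanes is an injective family indexed by 'I_n;
   the indexing is immaterial, it only records that there are n of them. *)
Definition is_arrangement (R : realType) (d n : nat)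
    (H : 'I_n -> set 'rV[R]_d) : Prop :=
  (forall i, is_hyperplane (H i)) /\ injective H.

Definition is_simple (R : realType) (d n : nat)
    (H : 'I_n -> set 'rV[R]_d) : Prop :=
  [/\ (d.+1 <= n)%N,
      forall J : {set 'I_n}, #|J| = d ->
        exists p : 'rV[R]_d, \bigcap_(i in [set` J]) H i = [set p]
    & forall J K : {set 'I_n}, #|J| = d -> #|K| = d -> J <> K ->
        \bigcap_(i in [set` J]) H i <> \bigcap_(i in [set` K]) H i].

Definition complement (R : realType) (d n : nat)
    (H : 'I_n -> set 'rV[R]_d) : set 'rV[R]_d :=
  ~` \bigcup_i H i.

Definition is_cell (R : realType) (d n : nat)
    (H : 'I_n -> set 'rV[R]_d) (C : set 'rV[R]_d) : Prop :=
  exists2 x, complement H x &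
    C = closure (connected_component (complement H) x).

(* S has affine dimension k: the largest affinely independent families
   p, x_1, ..., x_m of points of S have m = k. No k works for the empty set. *)
Definition has_dim (R : realType) (d : nat) (S : set 'rV[R]_d)
    (k : nat) : Prop :=
  (exists p : 'rV[R]_d, exists s : seq 'rV[R]_d,
     [/\ S p, forall x, x \in s -> S x, free [seq x - p | x <- s]
       & size s = k]) /\
  (forall (p : 'rV[R]_d) (s : seq 'rV[R]_d),
     S p -> (forall x, x \in s -> S x) -> free [seq x - p | x <- s] ->
     (size s <= k)%N).

(* Faces of a polyhedron P are cut out by its valid inequalities. The choice
   c = 0 is allowed, and yields P itself (b = 0) and the empty set (b > 0). *)
Definition is_face (R : realType) (d : nat) (P F : set 'rV[R]_d) : Prop :=
  exists c : 'rV[R]_d, exists b : R,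
    (forall x, P x -> dotp c x <= b) /\
    F = P `&` [set x : 'rV[R]_d | dotp c x = b].

Definition is_kface (R : realType) (d k : nat) (P F : set 'rV[R]_d) : Prop :=
  is_face P F /\ has_dim F k.

Definition arrangement_kface (R : realType) (d n k : nat)
    (H : 'I_n -> set 'rV[R]_d) (F : set 'rV[R]_d) : Prop :=
  exists2 C, is_cell H C & is_kface k C F.

Definition is_facet (R : realType) (d n : nat)
    (H : 'I_n -> set 'rV[R]_d) (F : set 'rV[R]_d) : Prop :=
  arrangement_kface d.-1 H F.

(* A facet belongs to a cell when it is one of the (d-1)-faces of that cell. *)
Definition external_facets (R : realType) (d n : nat)
    (H : 'I_n -> set 'rV[R]_d) : set (set 'rV[R]_d) :=
  [set F | is_facet H F /\
    exists! C, [/\ is_cell H C, bounded_set C & is_kface d.-1 C F]].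

(* Main.v *)
Require Import Defs.
From HB Require Import structures.
From mathcomp Require Import all_boot all_order all_algebra finmap.
From mathcomp Require Import all_classical all_reals all_analysis.
From mathcomp Require Import fintype finset.
From mathcomp Require Import ring lra zify.

Set Implicit Arguments.
Unset Strict Implicit.
Unset Printing Implicit Defensive.

Import Order.TTheory GRing.Theory Num.Theory.
Import numFieldNormedType.Exports.

Local Open Scope ring_scope.

(** An external facet separates a bounded cell from an unbounded one, so the
    external facets are the bounded facets of the unbounded cells, and one can
    count them cell by cell. An unbounded cell with [V] vertices, [E] edges and
    [F] facets satisfies Euler's relation [V - E + F = 1]; in a simple
    arrangement each vertex of a cell lies on three of its edges, a bounded edge
    has two vertices and an unbounded one has a single vertex, so that
    [3 V = 2 E_b + E_u] and hence [3 F_b = 3 + E_b + 2 E_u - 3 F_u], where [b]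
    and [u] stand for bounded and unbounded. The unbounded cells, facets and
    edges correspond to the regions, arcs and vertices that the planes cut out
    on the sphere of directions, and Euler's relation there gives their
    numbers. Summation over the unbounded cells yields
    [3 #(external facets) = 6 - n (n - 1) + P], where [P] is the number of
    incidences between bounded edges and unbounded cells.

    It remains to see that [P] is at least [2 n (n - 1)], the number of
    unbounded regions into which the planes are divided by each other. In the
    line arrangement induced in a plane, any three consecutive unbounded
    regions have at least two bounded edges in total ([window_bwalls]), so there
    are on average at least [2 / 3] bounded edges for each unbounded region.
    Around a bounded edge there are at most two unbounded facets, and they are
    never opposite; since both cells at an unbounded facet are unbounded, the
    unbounded cells are at least [3 / 2] times as many as the unbounded facets
    ([ufacets_ucells]). The outcome is that three times the number of external
    facets is at least [n (n - 1) + 6] ([card_external]), which exceeds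
    [n (n - 2) + 6].

    These arguments use only the sign vectors of the points and directions of
    space with respect to the planes. In homogeneous coordinates, with the plane
    at infinity as an additional element, they are the sign vectors of the
    nonzero vectors of a four-dimensional space with respect to linear forms in
    general position, and thus the covectors of a uniform oriented matroid of
    rank 4 ([uniform_rank4]), which is all that the counting needs. A cell is
    unbounded when its sign vector remains a covector after its sign at infinity
    is replaced by zero. Topology enters only to identify closed cells with the
    polyhedra given by their sign vectors ([cell_polyhedron]), and bounded cells
    with those that contain no direction ([bounded_polyhedron]). *)

(** * Sign vectors and uniform oriented matroids of rank 4 *)

Section SignVectors.
Context {I : finType}.
Notation signvec := {ffun I -> option bool}.
Implicit Types (s t u g h e : signvec) (j k l : I) (c : option bool).

Definition neg_sign c := omap negb c.

Definition zeros s : {set I} := [set k | s k == None].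

Definition upd s k c : signvec := [ffun j => if j == k then c else s j].

Definition opp s : signvec := [ffun j => neg_sign (s j)].

Definition fill s t : signvec := [ffun j => if s j is Some b then Some b else t j].

Lemma neg_signK : involutive neg_sign.
Proof. by case=> [[]|]. Qed.

Lemma neg_sign_eq c : (neg_sign c == c) = (c == None).
Proof. by case: c => [[]|]. Qed.

Lemma neg_sign_None c : (neg_sign c == None) = (c == None).
Proof. by case: c => [[]|]. Qed.

Lemma signs_neq c c' : c != None -> c' != None -> c != c' -> c' = neg_sign c.
Proof. by case: c c' => [[]|] [[]|]. Qed.

Lemma updE s k c j : upd s k c j = if j == k then c else s j.
Proof. by rewrite ffunE. Qed.

Lemma upd_same s k c : upd s k c k = c.
Proof. by rewrite updE eqxx. Qed.

Lemma upd_other s k c j : j != k -> upd s k c j = s j.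
Proof. by rewrite updE => /negPf->. Qed.

Lemma upd_id s k : upd s k (s k) = s.
Proof. by apply/ffunP=> j; rewrite updE; case: eqP => [->|]. Qed.

Lemma upd_upd s k c c' : upd (upd s k c) k c' = upd s k c'.
Proof. by apply/ffunP=> j; rewrite !updE; case: eqP. Qed.

Lemma updC s k l c c' : k != l -> upd (upd s k c) l c' = upd (upd s l c') k c.
Proof.
move=> kl; apply/ffunP=> j; rewrite !updE.
by case: (eqVneq j l) => [->|//]; rewrite eq_sym (negPf kl).
Qed.

Lemma oppE s j : opp s j = neg_sign (s j).
Proof. by rewrite ffunE. Qed.

Lemma fillE s t j : fill s t j = if s j is Some b then Some b else t j.
Proof. by rewrite ffunE. Qed.

Lemma in_zeros s k : (k \in zeros s) = (s k == None).
Proof. by rewrite inE. Qed.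

Lemma zeros_opp s : zeros (opp s) = zeros s.
Proof. by apply/setP=> j; rewrite !in_zeros oppE neg_sign_None. Qed.

Lemma zeros_upd_None s k : zeros (upd s k None) = k |: zeros s.
Proof. by apply/setP=> j; rewrite !inE updE; case: (eqVneq j k). Qed.

Lemma zeros_upd_Some s k b : zeros (upd s k (Some b)) = zeros s :\ k.
Proof. by apply/setP=> j; rewrite !inE updE; case: (eqVneq j k). Qed.

Lemma card_zeros_upd_None s k : s k != None ->
  #|zeros (upd s k None)| = #|zeros s|.+1.
Proof. by move=> sk; rewrite zeros_upd_None cardsU1 in_zeros sk. Qed.

Lemma card_zeros_upd_Some s k b : s k = None ->
  #|zeros (upd s k (Some b))|.+1 = #|zeros s|.
Proof. by move=> sk; rewrite zeros_upd_Some [RHS](cardsD1 k) in_zeros sk. Qed.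

Lemma card_zeros_swap s k b b' : s k = Some b ->
  #|zeros (upd s k (Some b'))| = #|zeros s|.
Proof.
move=> sk; rewrite zeros_upd_Some; apply: eq_card => j; rewrite !inE.
by case: eqVneq => // ->; rewrite sk.
Qed.

(** The covectors of a uniform oriented matroid of rank 4. The model is the set
    of sign vectors of the nonzero vectors of a four-dimensional space with
    respect to linear forms any four of which are independent. A form that
    vanishes at a vector can be made positive or negative by a small move that
    keeps the other signs ([upd_cov]); the segment between two vectors meets
    each hyperplane that separates them, and avoids the origin when some form
    has the same nonzero sign at both ends ([elim_cov]); three forms vanish
    together on a line ([vertex_cov], [vertex_unique]). *)
Record uniform_rank4 (L : {set signvec}) : Prop := UniformRank4 {
  opp_cov : forall s, s \in L -> opp s \in L;
  upd_cov : forall s k c, s \in L -> s k = None -> upd s k c \in L;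
  elim_cov : forall s t k j, s \in L -> t \in L -> s j = t j -> s j != None ->
    t k = neg_sign (s k) ->
    exists2 u, u \in L & u k = None /\ forall l, s l = t l -> u l = s l;
  rank_cov : forall s, s \in L -> (#|zeros s| <= 3)%N;
  vertex_cov : forall Z : {set I}, #|Z| = 3 -> exists2 s, s \in L & zeros s = Z;
  vertex_unique : forall s t, s \in L -> t \in L -> zeros s = zeros t ->
    #|zeros s| = 3 -> s = t \/ s = opp t }.

Variable L : {set signvec}.
Hypothesis HL : uniform_rank4 L.

Lemma vertex_eq s t (Z : {set I}) j : s \in L -> t \in L -> #|Z| = 3 ->
  Z \subset zeros s -> Z \subset zeros t -> s j = t j -> s j != None -> s = t.
Proof.
move=> sL tL Z3 Zs Zt stj sj.
have full r : r \in L -> Z \subset zeros r -> zeros r = Z.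
  move=> rL Zr; apply/esym/eqP; rewrite eqEcard Zr Z3; exact: (rank_cov HL).
have Es := full _ sL Zs; have Et := full _ tL Zt.
case: (vertex_unique HL sL tL) => //; rewrite ?Es ?Et // => sE.
by move: stj sj; rewrite sE oppE => /eqP; rewrite neg_sign_eq neg_sign_None => ->.
Qed.

(** All the zeros of a covector can be perturbed one after the other. *)
Lemma fill_cov s t : s \in L -> fill s t \in L.
Proof.
have [m] := ubnP #|[set j | (s j == None) && (t j != None)]|.
elim: m s => // m IHm s lem sL.
case: (set_0Vmem [set j | (s j == None) && (t j != None)]) => [D0|[k]].
  suff -> : fill s t = s by [].
  apply/ffunP => j; rewrite fillE; case sj: (s j) => [//|].
  by move/setP: D0 => /(_ j); rewrite !inE sj /= => /negbFE/eqP.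
move=> kD; have := kD; rewrite inE => /andP[/eqP sk tk].
have -> : fill s t = fill (upd s k (t k)) t.
  apply/ffunP=> j; rewrite !fillE updE; case: (eqVneq j k) => // ->.
  by rewrite sk; case: (t k).
apply: IHm; last exact: (upd_cov HL).
rewrite ltnS in lem; apply: leq_trans lem; apply: proper_card.
apply/properP; split; last by exists k => //; rewrite inE upd_same (negPf tk).
apply/subsetP=> j; rewrite !inE updE.
by case: (eqVneq j k) => // ->; rewrite (negPf tk).
Qed.

Definition agree (E : {set I}) s t := [forall k in E, t k == s k].

Lemma agreeP (E : {set I}) s t :
  reflect (forall k, k \in E -> t k = s k) (agree E s t).
Proof. exact: 'forall_in_eqP. Qed.

Lemma agreeU1 (E : {set I}) k s t :
  agree (k |: E) s t = agree E s t && (t k == s k).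
Proof.
apply/agreeP/andP => [H|[/agreeP H /eqP tk] j].
  split; last by apply/eqP/H; rewrite setU11.
  by apply/agreeP=> j jE; apply: H; rewrite setU1r.
by rewrite !inE => /orP[/eqP->|/H].
Qed.

Lemma sum_by_sign (P : pred signvec) k :
  \sum_(t in L | P t) (-1) ^+ #|zeros t| =
  \sum_(t in L | P t && (t k == None)) (-1) ^+ #|zeros t|
  + \sum_(t in L | P t && (t k == Some true)) (-1) ^+ #|zeros t|
  + \sum_(t in L | P t && (t k == Some false)) (-1) ^+ #|zeros t| :> int.
Proof.
rewrite (bigID (fun t => t k == None)) /= -addrA; congr (_ + _).
  by apply: eq_bigl => t; rewrite -andbA.
rewrite (bigID (fun t => t k == Some true)) /=; congr (_ + _);
  by apply: eq_bigl => t; case: (t k) => [[]|]; rewrite -?andbA ?andbF.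
Qed.

(** Euler's relation for a relatively open convex cone cut out by prescribing
    the signs in [E]: adding one more hyperplane either misses the cone, or
    splits it into two cones of the same dimension and one of dimension one
    less, and both sides of the claimed identity behave alike. *)
Lemma euler_agree (E : {set I}) s j : s \in L -> j \in E -> s j != None ->
  \sum_(t in L | agree E s t) (-1) ^+ #|zeros t| = (-1) ^+ #|E :&: zeros s| :> int.
Proof.
have [m] := ubnP #|~: E|.
elim: m E s => // m IHm E s lem sL jE sj.
case: (set_0Vmem (~: E)) => [E0|[k]].
  have ET : E = setT by rewrite -[E]setCK E0 setC0.
  rewrite (big_pred1 s) ?ET ?setTI // => t /=.
  apply/andP/eqP => [[_ /agreeP ts]|->]; first by apply/ffunP=> l; apply: ts.
  by split=> //; apply/agreeP.
rewrite inE => kE.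
have kj : j != k by apply: contraNneq kE => <-.
have IH r : r \in L -> agree E s r ->
    \sum_(t in L | agree E s t && (t k == r k)) (-1) ^+ #|zeros t|
      = (-1) ^+ #|(k |: E) :&: zeros r| :> int.
  move=> rL sr; rewrite -IHm ?inE ?jE ?orbT //; first last.
  - by move/agreeP: sr => ->.
  - rewrite ltnS in lem; apply: leq_trans lem; apply: proper_card.
    by rewrite setCU setIC -setDE properD1 // inE.
  apply: eq_bigl => t; rewrite agreeU1; congr (_ && (_ && _)).
  by move/agreeP: sr => sr; apply/agreeP/agreeP => H l lE; rewrite H // sr.
have cardE r : r \in L -> agree E s r ->
    #|(k |: E) :&: zeros r| = ((r k == None) + #|E :&: zeros s|)%N.
  move=> rL /agreeP sr; rewrite (cardsD1 k) !inE eqxx /=; congr (_ + _)%N.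
  apply: eq_card => l; rewrite !inE.
  case: (eqVneq l k) => [->|_] /=; first by rewrite (negPf kE).
  by case lE: (l \in E) => //=; rewrite sr.
case: (pickP [pred t in L | agree E s t && (t k == None)]) => [t0|no0].
  move=> /= /and3P[tL st /eqP tk].
  have upd_in c : upd t0 k c \in L /\ agree E s (upd t0 k c).
    split; first exact: (upd_cov HL).
    apply/agreeP=> l lE; rewrite upd_other ?(agreeP _ _ _ st) //.
    by apply: contraNneq kE => <-.
  have E1 c : \sum_(t in L | agree E s t && (t k == c)) (-1) ^+ #|zeros t|
      = (-1) ^+ ((c == None) + #|E :&: zeros s|) :> int.
    have [uL us] := upd_in c; move: (IH _ uL us); rewrite cardE // upd_same.
    by move=> <-.
  by rewrite (sum_by_sign _ k) !E1 /= !add0n add1n exprS mulN1r addNr add0r.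
have sk : s k != None by have := no0 s; rewrite /= sL; case: agreeP => //= _ ->.
rewrite -[#|_ :&: _|]add0n -[X in (X + _)%N](_ : (s k == None) = 0%N :> nat);
  last by rewrite (negPf sk).
have sas : agree E s s by apply/agreeP.
rewrite -cardE // -IH //.
apply: eq_bigl => t; case tL: (t \in L) => //=.
case st: (agree E s t) => //=; apply/esym/eqP.
apply/eqP; apply: contraT => tk.
have tk0 : t k != None by have := no0 t; rewrite /= tL st /= => ->.
have tjs : t j = s j by move/agreeP: st => ->.
have tks : t k = neg_sign (s k) by apply: signs_neq => //; rewrite eq_sym.
have [u uL [uk us]] := elim_cov HL sL tL (esym tjs) sj tks.
have := no0 u; rewrite /= uL uk eqxx andbT => <-; apply/agreeP=> l lE.
by rewrite us // (agreeP _ _ _ st).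
Qed.

(** * Walls, and the two ends of an edge *)

Definition walls s : {set I} := [set k | (s k != None) && (upd s k None \in L)].

Lemma wallsP s k : reflect (s k != None /\ upd s k None \in L) (k \in walls s).
Proof. by rewrite inE; apply: andP. Qed.

(** Elimination of a form that separates [s] from [t] gives a point between them;
    if it is not on a wall of [s], it can be perturbed to a place that fewer forms
    separate from [s]. *)
Lemma wall_between s t j : s \in L -> t \in L -> zeros s = zeros t ->
  s j = t j -> s j != None -> s != t -> exists2 k, k \in walls s & s k != t k.
Proof.
have [m] := ubnP #|[set k | s k != t k]|.
elim: m t => // m IHm t lem sL tL Z stj sj st.
have zst l : (s l == None) = (t l == None) by rewrite -!in_zeros Z.
case: (set_0Vmem [set k | s k != t k]) => [D0|[k]].
  case/negP: st; apply/eqP/ffunP=> l.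
  by move/setP: D0 => /(_ l); rewrite !inE => /negbFE/eqP.
rewrite inE => stk.
have sk : s k != None.
  by apply: contraNneq stk => sk; move: (zst k); rewrite sk => /esym/eqP->.
have tk : t k != None by rewrite -zst.
have [u uL [uk us]] := elim_cov HL sL tL stj sj (signs_neq sk tk stk).
have [vs|vs] := eqVneq s (fill u s).
  exists k => //; apply/wallsP; split=> //.
  have -> : upd s k None = fill u (upd s k None); last exact: fill_cov.
  apply/ffunP=> l; rewrite fillE updE; case: (eqVneq l k) => [->|lk].
    by rewrite uk.
  by move/ffunP: vs => /(_ l); rewrite fillE; case: (u l).
have [|||k' k'w sk'] := IHm (fill u s) _ sL (fill_cov _ uL) _ _ sj vs.
- rewrite ltnS in lem; apply: leq_trans lem; apply: proper_card.
  apply/properP; split; last by exists k; rewrite inE ?fillE ?uk ?eqxx.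
  apply/subsetP=> l; rewrite !inE; apply: contraNneq => stl.
  by rewrite fillE us //; case: (s l).
- apply/setP=> l; rewrite !in_zeros fillE; case ul: (u l) => [b|] //.
  have [stl|] := eqVneq (s l) (t l); first by move: ul; rewrite us // => ->.
  by apply: contraNF => /eqP sl; move: (zst l); rewrite sl eqxx => /esym/eqP->.
- by rewrite fillE us //; case: (s j).
exists k' => //; apply: contra sk' => /eqP stk'.
by rewrite fillE us //; case: (s k').
Qed.

Lemma ex_notin (A : {set I}) : (#|A| < #|I|)%N -> exists k, k \notin A.
Proof.
move=> lA; case: (set_0Vmem (~: A)) => [A0|[k]]; last by rewrite inE; exists k.
by move: (cardsC A) lA; rewrite A0 cards0 addn0 => ->; rewrite ltnn.
Qed.

Hypothesis cardI : (6 <= #|I|)%N.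

(** The end is found by walking towards a vertex [v] of the line, perturbed
    across [v] to the far side of the form [j] that vanishes there. *)
Lemma edge_wall_other s l : s \in L -> #|zeros s| = 2 -> s l != None ->
  exists2 k, k \in walls s & k != l.
Proof.
move=> sL s2 sl.
have [|j] := @ex_notin (l |: zeros s).
  by rewrite cardsU1 s2; apply: leq_trans cardI; case: (_ \notin _).
rewrite !inE negb_or => /andP[jl sj].
have Z3 : #|j |: zeros s| = 3 by rewrite cardsU1 in_zeros sj s2.
have [v vL [vZ vl]] : exists2 v, v \in L & zeros v = j |: zeros s /\ v l = s l.
  have [v vL vZ] := vertex_cov HL Z3.
  have vl0 : v l != None by rewrite -in_zeros vZ !inE negb_or eq_sym jl.
  have [vl|vl] := eqVneq (v l) (s l); first by exists v.
  exists (opp v); first exact: (opp_cov HL).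
  by rewrite zeros_opp; split=> //; rewrite oppE -(signs_neq vl0 sl vl).
have vj : v j = None by apply/eqP; rewrite -in_zeros vZ !inE eqxx.
have nsj : neg_sign (s j) != None by rewrite neg_sign_None.
have [||||k kw] := @wall_between s (upd v j (neg_sign (s j))) l sL
    (upd_cov HL _ vL vj).
- case E: (neg_sign (s j)) nsj => [b|//] _; rewrite zeros_upd_Some vZ.
  by apply/setP=> k; rewrite !inE; case: (eqVneq k j) => //= ->; rewrite (negPf sj).
- by rewrite upd_other // eq_sym.
- exact: sl.
- apply/eqP=> E; move: nsj; rewrite -neg_sign_None.
  have := neg_sign_eq (s j); rewrite {2}E upd_same eqxx => /esym/eqP sj0.
  by rewrite sj0 in sj.
move=> sk; exists k => //; apply: contraNneq sk => ->.
by rewrite upd_other ?vl // eq_sym.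
Qed.

(** An edge, considered as an arc of a projective line, has two ends. If it had
    three ends [k], [l], [m], then crossing the ends [l] and [k] in turn would
    lead to two places of the line that the form [m] separates, while at its own
    zero the form [m] sees the signs of the edge at both [k] and [l]. *)
Lemma card_edge_walls s : s \in L -> #|zeros s| = 2 -> #|walls s| = 2.
Proof.
move=> sL s2; apply/eqP; rewrite eqn_leq; apply/andP; split.
  rewrite leqNgt; apply/card_gt2P => -[k [l [m [[]]]]].
  move=> /wallsP[sk skL] /wallsP[sl slL] /wallsP[sm smL] [kl lm mk].
  pose a := upd s l (neg_sign (s l)).
  pose b := opp (upd s k (neg_sign (s k))).
  have aL : a \in L by rewrite /a -(upd_upd s l None); apply: (upd_cov HL); rewrite ?upd_same.
  have bL : b \in L.
    by apply/(opp_cov HL); rewrite -(upd_upd s k None); apply: (upd_cov HL); rewrite ?upd_same.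
  have ak : a k = s k by rewrite upd_other.
  have bk : b k = s k by rewrite oppE upd_same neg_signK.
  have bm : b m = neg_sign (a m) by rewrite oppE !upd_other // eq_sym.
  have ab : a k = b k by rewrite ak bk.
  have ak0 : a k != None by rewrite ak.
  have [u uL [um us]] := elim_cov HL aL bL ab ak0 bm.
  have uk : u k = s k by rewrite us ?ak.
  have ul : u l = neg_sign (s l).
    by rewrite us /a upd_same // oppE upd_other // eq_sym.
  have sl' : upd s m None l = s l by rewrite upd_other.
  have uE : u = upd s m None.
    apply: (@vertex_eq _ _ (m |: zeros s) k) => //; rewrite ?uk //.
    - by rewrite cardsU1 in_zeros sm s2.
    - apply/subsetP=> i; rewrite !inE => /orP[/eqP->|/eqP si]; first by rewrite um.
      have il : i != l by apply: contraNneq sl => <-; rewrite si.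
      have ik : i != k by apply: contraNneq sk => <-; rewrite si.
      by rewrite us /a ?oppE !upd_other ?si.
    - by rewrite zeros_upd_None.
    - by rewrite upd_other // eq_sym.
  by move/eqP: ul; rewrite uE sl' eq_sym neg_sign_eq (negPf sl).
have [|l] := @ex_notin (zeros s); first by rewrite s2; apply: leq_trans cardI.
rewrite inE => sl.
have [j jw jl] := edge_wall_other sL s2 sl.
have [sj _] := wallsP _ _ jw.
have [k kw kj] := edge_wall_other sL s2 sj.
by rewrite (cardsD1 j) jw (cardsD1 k) !inE kj; have := kw; rewrite inE => ->.
Qed.

(** * Bounded edges of the unbounded regions in a plane *)

Variable o : I.

(** With [o] as the plane at infinity these are the generic directions for [z = 1],
    those along exactly one plane for [z = 2], and those of the lines for [z = 3]. *)
Definition dirs (z : nat) := [set h in L | (h o == None) && (#|zeros h| == z)].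

Lemma dirsP z h :
  reflect [/\ h \in L, h o = None & #|zeros h| = z] (h \in dirs z).
Proof. by rewrite !inE; apply: (iffP and3P) => -[? /eqP ? /eqP ?]. Qed.

(** The face that contains the distant points in the direction [h]. *)
Definition lift h := upd h o (Some true).

(** The neighbour of the face [h] across its wall [j]. *)
Definition nbr h j := upd h j (neg_sign (h j)).

(** The bounded walls of an unbounded region: [walls h] are those that reach
    infinity, and the plane at infinity itself is a wall of [lift h]. *)
Definition bwalls h := walls (lift h) :\: (o |: walls h).

Lemma lift_cov h : h \in L -> h o = None -> lift h \in L.
Proof. exact: (upd_cov HL). Qed.

Lemma walls_neq_o h j : h o = None -> j \in walls h -> j != o.
Proof. by move=> ho /wallsP[hj _]; apply: contraNneq hj => ->; rewrite ho. Qed.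

Lemma walls_lift h : h \in L -> h o = None -> walls h \subset walls (lift h).
Proof.
move=> hL ho; apply/subsetP=> j jw; have jo := walls_neq_o ho jw.
case/wallsP: jw => hj jL; apply/wallsP; split; first by rewrite upd_other.
by rewrite updC 1?eq_sym //; apply: (upd_cov HL) => //; rewrite upd_other // eq_sym.
Qed.

Lemma nbrK j : involutive (fun h : signvec => nbr h j).
Proof. by move=> h; rewrite /nbr upd_upd upd_same neg_signK upd_id. Qed.

Lemma nbr_dirs z h j : h \in dirs z -> j \in walls h -> nbr h j \in dirs z.
Proof.
case/dirsP => hL ho hz jw; have jo := walls_neq_o ho jw.
have [hj jL] := wallsP _ _ jw; apply/dirsP; split.
- by rewrite /nbr -(upd_upd h j None); apply: (upd_cov HL); rewrite ?upd_same.
- by rewrite upd_other // eq_sym.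
- by case E: (h j) hj => [b|//] _; rewrite /nbr E (card_zeros_swap _ E).
Qed.

Lemma nbr_wall h j : (j \in walls (nbr h j)) = (j \in walls h).
Proof. by rewrite !inE upd_same neg_sign_None upd_upd. Qed.

(** The end of the ray between a region and its neighbour is a vertex of both,
    so the second plane through it bounds the neighbour as well, and must do so
    at infinity when the neighbour has no bounded wall. *)
Lemma nbr_wall_at_vertex h j l : h \in dirs 2 -> j \in walls h ->
  l \in walls (upd (lift h) j None) -> l != o -> bwalls (nbr h j) = set0 ->
  l \in walls (nbr h j).
Proof.
case/dirsP => hL ho hz jw /wallsP[el lL] lo /setP/(_ l).
have jo := walls_neq_o ho jw.
have lj : l != j by apply: contraNneq el => ->; rewrite upd_same.
rewrite in_setD in_setU1 (negPf lo) /= in_set0 => /negbT.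
rewrite negb_and negbK => /orP[//|/negP[]].
apply/wallsP; rewrite -(nbrK j h) in el lL *.
rewrite !nbrK in el lL *.
split; first by rewrite !upd_other in el *.
have -> : upd (lift (nbr h j)) l None =
    upd (upd (upd (lift h) j None) l None) j (neg_sign (h j)).
  apply/ffunP=> i; rewrite !updE.
  by case: (eqVneq i j) => // ->; rewrite (negPf jo) eq_sym (negPf lj).
by apply: (upd_cov HL) => //; rewrite upd_other ?upd_same // eq_sym.
Qed.

(** Among six elements some element outside [A] is nonzero at [h]; there both
    vertices have the sign of [h], so they are not opposite. *)
Lemma vertex_eq_away h s t m (A : {set I}) : #|zeros h| = 2 -> h m != None ->
  s \in L -> t \in L ->
  m |: zeros h \subset zeros s -> m |: zeros h \subset zeros t ->
  (#|A| <= 3)%N -> (forall q, q \notin A -> h q != None -> s q = h q) ->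
  (forall q, q \notin A -> h q != None -> t q = h q) -> s = t.
Proof.
move=> h2 hm sL tL Zs Zt A3 Hs Ht.
have [|q] := @ex_notin (A :|: zeros h).
  apply: leq_trans cardI; rewrite ltnS cardsU h2.
  by apply: leq_trans (leq_subr _ _) _; exact: leq_add A3 (leqnn 2).
rewrite !inE negb_or => /andP[qA hq].
apply: (@vertex_eq _ _ (m |: zeros h) q); rewrite ?Hs ?Ht //.
by rewrite cardsU1 in_zeros hm h2.
Qed.

Lemma sub_zeros_nbr h j : zeros h \subset zeros (nbr h j).
Proof.
apply/subsetP=> i; rewrite !inE updE; case: (eqVneq i j) => // ->.
by rewrite neg_sign_None.
Qed.

(** The lines are those in which a plane meets the other planes. If the bound
    failed, there would be two neighbouring wedges with a common apex, or a
    region with one bounded edge between two wedges that have their apices at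
    the ends of this edge. Both cases give two different points at infinity on
    one line. *)
Lemma window_bwalls h : h \in dirs 2 ->
  (2 <= #|bwalls h| + \sum_(j in walls h) #|bwalls (nbr h j)|)%N.
Proof.
move=> hS; have [hL ho h2] := dirsP _ _ hS.
have GL := lift_cov hL ho.
have wL := subsetP (walls_lift hL ho).
case c0: #|bwalls h| => [|[|//]].
  (* The region is a wedge, and its apex also lies on the neighbour. *)
  have b0 : bwalls h = set0 by apply/eqP; rewrite -cards_eq0 c0.
  have s2 : (\sum_(j in walls h) 1 = 2)%N by rewrite sum1_card card_edge_walls.
  rewrite add0n -[X in (X <= _)%N]s2 leq_sum // => j jw.
  rewrite card_gt0; apply/eqP=> bn0.
  have jo := walls_neq_o ho jw.
  have [hj jL] := wallsP _ _ jw.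
  have [Gj eL] := wallsP _ _ (wL _ jw).
  have e2 : #|zeros (upd (lift h) j None)| = 2.
    rewrite card_zeros_upd_None //; apply: (etrans _ h2).
    by apply: (@card_zeros_upd_Some h o true).
  have eo : upd (lift h) j None o != None by rewrite upd_other 1?eq_sym // upd_same.
  have [m mw mo] := edge_wall_other eL e2 eo.
  have [em mL] := wallsP _ _ mw.
  have mj : m != j by apply: contraNneq em => ->; rewrite upd_same.
  have hm : h m != None by move: em; rewrite !upd_other.
  have mwG : m \in walls (lift h).
    apply/wallsP; split; first by move: em; rewrite upd_other.
    have -> : upd (lift h) m None =
        upd (upd (upd (lift h) j None) m None) j (lift h j).
      apply/ffunP=> i; rewrite !updE.
      by case: (eqVneq i j) => // ->; rewrite (eq_sym j m) (negPf mj).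
    by apply: (upd_cov HL) => //; rewrite upd_other ?upd_same // eq_sym.
  have mwh : m \in walls h.
    move/setP: b0 => /(_ m); rewrite in_setD in_setU1 (negPf mo) mwG andbT in_set0 /=.
    by move/negbFE.
  have mwn := nbr_wall_at_vertex hS jw mw mo bn0.
  have [_ m1] := wallsP _ _ mwh; have [_ m2] := wallsP _ _ mwn.
  have E : upd (nbr h j) m None = upd h m None.
    apply: (@vertex_eq_away h _ _ m [set j; m]) => //.
    - by rewrite zeros_upd_None setUS // sub_zeros_nbr.
    - by rewrite zeros_upd_None.
    - by rewrite cards2; case: (_ != _).
    - by move=> q; rewrite !inE negb_or => /andP[qj qm] _; rewrite !upd_other.
    - by move=> q; rewrite !inE negb_or => /andP[qj qm] _; rewrite !upd_other.
  have jm : j != m by rewrite eq_sym.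
  move/ffunP: E => /(_ j); rewrite !(upd_other _ _ jm).
  by rewrite upd_same => /eqP; rewrite neg_sign_eq (negPf hj).
rewrite add1n ltnS lt0n; apply/eqP => /eqP; rewrite sum_nat_eq0 => /forall_inP bn0.
(* There is a single bounded edge; it joins the ends of the two rays. *)
have [l bl] : exists l, bwalls h = [set l] by apply/cards1P; rewrite c0.
have : l \in bwalls h by rewrite bl set11.
rewrite !in_setD in_setU1 negb_or => /andP[/andP[lo lw] lG].
have [Gl eL] := wallsP _ _ lG.
have hl : h l != None by move: Gl; rewrite upd_other.
have e2 : #|zeros (upd (lift h) l None)| = 2.
  rewrite card_zeros_upd_None //; apply: (etrans _ h2).
  by apply: (@card_zeros_upd_Some h o true).
have sub : walls (upd (lift h) l None) \subset walls h.
  apply/subsetP=> m /wallsP[em mL].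
  have ml : m != l by apply: contraNneq em => ->; rewrite upd_same.
  have mo : m != o.
    apply: contraNneq lw => mo; apply/wallsP; split=> //.
    have -> : upd h l None = upd (upd (lift h) l None) m None; last by [].
    rewrite mo; apply/ffunP=> i; rewrite !updE.
    by case: (eqVneq i o) => // ->; rewrite ho; case: ifP.
  have : m \notin bwalls h by rewrite bl inE.
  rewrite in_setD in_setU1 (negPf mo) /= negb_and negbK.
  case/orP=> // /negP[]; apply/wallsP; split; first by move: em; rewrite upd_other.
  have -> : upd (lift h) m None =
      upd (upd (upd (lift h) l None) m None) l (lift h l).
    apply/ffunP=> i; rewrite !updE.
    by case: (eqVneq i l) => // ->; rewrite (eq_sym l m) (negPf ml).
  by apply: (upd_cov HL) => //; rewrite upd_other ?upd_same // eq_sym.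
have wE : walls (upd (lift h) l None) = walls h.
  by apply/eqP; rewrite eqEcard sub !card_edge_walls.
have key j : j \in walls h -> upd (nbr h j) l None \in L.
  move=> jw; have jo := walls_neq_o ho jw.
  have /wallsP[ej jL] : j \in walls (upd (lift h) l None) by rewrite wE.
  have lj : l != j by apply: contraNneq ej => <-; rewrite upd_same.
  suff /wallsP[] : l \in walls (nbr h j) by [].
  apply: nbr_wall_at_vertex => //; last by apply/eqP; rewrite -cards_eq0 bn0.
  by apply/wallsP; split; [rewrite upd_other | rewrite updC // eq_sym].
have /eqP/cards2P[j [k [jk wjk]]] := card_edge_walls hL h2.
have jw : j \in walls h by rewrite wjk !inE eqxx.
have kw : k \in walls h by rewrite wjk !inE eqxx orbT.
have hj : h j != None by case/wallsP: jw.
have lj : l != j by apply: contraNneq lw => ->.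
have E : upd (nbr h j) l None = upd (nbr h k) l None.
  apply: (@vertex_eq_away h _ _ l [set j; k; l]); rewrite ?key //.
  - by rewrite zeros_upd_None setUS // sub_zeros_nbr.
  - by rewrite zeros_upd_None setUS // sub_zeros_nbr.
  - by rewrite setUC cardsU1 cards2; case: (_ \notin _); case: (_ != _).
  - move=> q; rewrite !inE !negb_or -andbA => /and3P[qj qk ql] _.
    by rewrite !upd_other.
  - move=> q; rewrite !inE !negb_or -andbA => /and3P[qj qk ql] _.
    by rewrite !upd_other.
have jl : j != l by rewrite eq_sym.
move/ffunP: E => /(_ j); rewrite !(upd_other _ _ jl).
by rewrite upd_same upd_other // => /eqP; rewrite neg_sign_eq (negPf hj).
Qed.

(** A region belongs to three windows: its own and those of its two neighbours. *)
Lemma sum_bwalls : (2 * #|dirs 2| <= 3 * \sum_(h in dirs 2) #|bwalls h|)%N.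
Proof.
apply: leq_trans (_ : \sum_(h in dirs 2)
   (#|bwalls h| + \sum_(j in walls h) #|bwalls (nbr h j)|) <= _)%N.
  by rewrite mulnC -sum_nat_const; apply: leq_sum => h; apply: window_bwalls.
rewrite big_split /= mulSn leq_add2l.
rewrite (exchange_big_dep predT) //=.
rewrite (eq_bigr (fun j => \sum_(h in dirs 2 | j \in walls h) #|bwalls h|)%N); last first.
  move=> j _; rewrite [RHS](reindex_inj (inv_inj (nbrK j))) /=.
  apply: eq_bigl => h; rewrite nbr_wall; case jw: (j \in walls h); rewrite ?andbF // !andbT.
  apply/idP/idP => [hS|]; first exact: nbr_dirs.
  by move/nbr_dirs => /(_ j); rewrite nbr_wall nbrK; apply.
rewrite -(exchange_big_dep predT) //= big_distrr /=; apply: leq_sum => h /dirsP[hL _ h2].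
by rewrite sum_nat_const card_edge_walls.
Qed.

(** * Euler's relations and the faces at infinity *)

Lemma vertex_sign (Z : {set I}) k b : #|Z| = 3 -> k \notin Z ->
  exists2 v, v \in L & zeros v = Z /\ v k = Some b.
Proof.
move=> Z3 kZ; have [v vL vZ] := vertex_cov HL Z3.
have vk0 : v k != None by rewrite -in_zeros vZ.
have [vk|vk] := eqVneq (v k) (Some b); first by exists v.
exists (opp v); first exact: (opp_cov HL).
by rewrite zeros_opp oppE -(signs_neq vk0 _ vk).
Qed.

Lemma card_vertices (Z : {set I}) : #|Z| = 3 ->
  #|[set t in L | zeros t == Z]| = 2.
Proof.
move=> Z3; have [v vL vZ] := vertex_cov HL Z3.
suff -> : [set t in L | zeros t == Z] = [set v; opp v].
  rewrite cards2; suff -> : v != opp v by [].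
  have [|k] := @ex_notin Z; first by rewrite Z3; apply: leq_trans cardI.
  rewrite -vZ in_zeros; apply: contraNneq => /ffunP/(_ k)/esym/eqP.
  by rewrite oppE neg_sign_eq.
apply/setP=> t; rewrite !inE; apply/andP/orP => [[tL /eqP tZ]|].
  case: (vertex_unique HL tL vL); rewrite ?tZ ?vZ // => ->; rewrite eqxx; auto.
case=> /eqP->; first by rewrite vL vZ eqxx.
by rewrite zeros_opp vZ eqxx (opp_cov HL).
Qed.

Definition ncov (z : nat) (P : pred signvec) := #|[set t in L | P t && (#|zeros t| == z)]|.

Lemma alternating_sum (P : pred signvec) :
  \sum_(t in L | P t) (-1) ^+ #|zeros t| =
  (ncov 0%N P)%:Z - (ncov 1%N P)%:Z + (ncov 2%N P)%:Z - (ncov 3%N P)%:Z :> int.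
Proof.
transitivity (\sum_(i < 4) (-1) ^+ i *+ ncov i P : int).
  rewrite (partition_big (fun t => inord #|zeros t| : 'I_4) predT) //=.
  apply: eq_bigr => i _; rewrite -sumr_const.
  have zi t : t \in L -> (inord #|zeros t| == i :> 'I_4) = (#|zeros t| == i).
    by move=> tL; rewrite -val_eqE /= inordK // ltnS (rank_cov HL).
  apply: eq_big => t.
    by rewrite inE; case tL: (t \in L) => //=; rewrite zi.
  by case/andP=> /andP[tL _]; rewrite zi // => /eqP->.
rewrite !big_ord_recl big_ord0 /= addr0 expr0 expr1 sqrrN expr1n exprS sqrrN expr1n mulr1.
by rewrite !mulNrn !natz !addrA.
Qed.

Lemma agree2 k l s t : agree [set k; l] s t = (t k == s k) && (t l == s l).
Proof.
apply/agreeP/andP => [H|[/eqP tk /eqP tl] i]; last by rewrite !inE => /orP[]/eqP->.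
by rewrite !H ?inE ?eqxx ?orbT.
Qed.

(** Euler's relation on the sphere of directions. A plane divides the sphere into
    two open hemispheres, and a second one divides their common boundary circle
    into two open arcs and two points. *)
Lemma euler_dirs : (#|dirs 1| + #|dirs 3| = #|dirs 2| + 2)%N.
Proof.
have [|k] := @ex_notin [set o]; first by rewrite cards1; apply: leq_trans cardI.
rewrite inE => ko.
have [|l] := @ex_notin [set o; k].
  by rewrite cards2 eq_sym ko; apply: leq_trans cardI.
rewrite !inE negb_or => /andP[lo lk].
have card3 i j m : i != j -> m != i -> m != j -> #|[set i; j; m]| = 3.
  by move=> ij mi mj; rewrite setUC cardsU1 cards2 ij !inE negb_or mi mj.
have sum1 b : \sum_(t in L | (t o == None) && (t k == Some b))
    (-1) ^+ #|zeros t| = -1 :> int.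
  have [|m] := @ex_notin [set o; k; l].
    by rewrite card3 // ?(eq_sym o) //; apply: leq_trans cardI.
  rewrite !inE !negb_or -andbA => /and3P[mo mk ml].
  have [||s sL [sZ sk]] := @vertex_sign [set o; l; m] k b.
  - by rewrite card3 // eq_sym.
  - by rewrite !inE !negb_or ko eq_sym lk eq_sym mk.
  have so : s o = None by apply/eqP; rewrite -in_zeros sZ !inE eqxx.
  have := @euler_agree [set o; k] s k sL; rewrite !inE eqxx orbT sk => /(_ isT isT).
  under eq_bigl do rewrite agree2 so sk.
  move=> ->; suff -> : [set o; k] :&: zeros s = [set o] by rewrite cards1.
  apply/setP=> i; rewrite !inE; case: (eqVneq i o) => [->|_] /=; first by rewrite so.
  by case: (eqVneq i k) => // ->; rewrite sk.
have sum2 b : \sum_(t in L | (t o == None) && (t k == None) && (t l == Some b))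
    (-1) ^+ #|zeros t| = 1 :> int.
  have [|m] := @ex_notin [set o; k; l].
    by rewrite card3 // ?(eq_sym o) //; apply: leq_trans cardI.
  rewrite !inE !negb_or -andbA => /and3P[mo mk ml].
  have [||s sL [sZ sl]] := @vertex_sign [set o; k; m] l b.
  - by rewrite card3 // eq_sym.
  - by rewrite !inE !negb_or lo lk eq_sym ml.
  have so : s o = None by apply/eqP; rewrite -in_zeros sZ !inE eqxx.
  have sk : s k = None by apply/eqP; rewrite -in_zeros sZ !inE eqxx orbT.
  have := @euler_agree (l |: [set o; k]) s l sL; rewrite !inE eqxx sl => /(_ isT isT).
  under eq_bigl do rewrite agreeU1 agree2 so sk sl.
  move=> ->; suff -> : (l |: [set o; k]) :&: zeros s = [set o; k].
    by rewrite cards2 eq_sym ko.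
  apply/setP=> i; rewrite !inE; case: (eqVneq i o) => [->|_] /=; first by rewrite so orbT.
  case: (eqVneq i k) => [->|_]; rewrite ?sk ?orbT ?orbF //=.
  by case: eqP => // ->; rewrite sl.
have sum3 : \sum_(t in L | (t o == None) && (t k == None) && (t l == None))
    (-1) ^+ #|zeros t| = -2 :> int.
  have Z3 : #|[set o; k; l]| = 3 by rewrite card3 // eq_sym.
  rewrite (eq_bigl (fun t => t \in [set t in L | zeros t == [set o; k; l]])).
    rewrite (eq_bigr (fun=> -1)); last by move=> t; rewrite inE => /andP[_ /eqP->]; rewrite Z3.
    by rewrite sumr_const card_vertices.
  move=> t; rewrite !inE; case tL: (t \in L) => //=.
  apply/andP/eqP => [[/andP[to tk] tl]|tZ]; last by rewrite -!in_zeros tZ !inE !eqxx !orbT.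
  apply/esym/eqP; rewrite eqEcard Z3 (rank_cov HL) // andbT.
  by apply/subsetP=> i; rewrite !inE -orbA => /or3P[]/eqP->.
have := sum_by_sign (fun t => t o == None) k; rewrite !sum1.
rewrite (sum_by_sign (fun t => (t o == None) && (t k == None)) l) !sum2 sum3.
have nE z : ncov z (fun t => t o == None) = #|dirs z| by [].
have n0 : #|dirs 0| = 0%N.
  apply/eqP; rewrite cards_eq0 -subset0; apply/subsetP=> t /dirsP[_ to].
  by move/eqP; rewrite cards_eq0 => /eqP/setP/(_ o); rewrite !inE to.
rewrite alternating_sum !nE n0; lia.
Qed.

Lemma sum_card_swap (T U : finType) (A : {set T}) (F : T -> {set U}) :
  (\sum_(t in A) #|F t| = \sum_u #|[set t in A | u \in F t]|)%N.
Proof.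
under eq_bigr do rewrite -sum1_card.
rewrite (exchange_big_dep predT) //=; apply: eq_bigr => k _.
by rewrite -sum1_card; apply: eq_bigl => t; rewrite inE.
Qed.

Lemma upd_inj_zero k c s t : s k = t k -> upd s k c = upd t k c -> s = t.
Proof. by move=> st E; rewrite -(upd_id s k) -(upd_upd s k c) E upd_upd st upd_id. Qed.

(** An arc of directions has two ends, and a point is the end of four arcs. *)
Lemma card_dirs23 : (#|dirs 2| <= 2 * #|dirs 3|)%N.
Proof.
rewrite -(leq_pmul2l (isT : 0 < 2)%N).
have -> : (2 * #|dirs 2| = \sum_(h in dirs 2) #|walls h|)%N.
  rewrite mulnC -sum_nat_const; apply: eq_bigr => h /dirsP[hL _ h2].
  by rewrite card_edge_walls.
rewrite sum_card_swap.
have -> : (2 * (2 * #|dirs 3|) = \sum_k 2 * #|[set v in dirs 3 | k \in zeros v :\ o]|)%N.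
  rewrite -big_distrr -sum_card_swap /=; congr (2 * _)%N.
  rewrite mulnC -sum_nat_const; apply: eq_bigr => v /dirsP[_ vo v3].
  by move: v3; rewrite (cardsD1 o) in_zeros vo eqxx => -[].
apply: leq_sum => k _.
set B := [set v in dirs 3 | _].
have -> : (2 * #|B| = #|setX B [set: bool]|)%N.
  by rewrite cardsX cardsT card_bool mulnC.
pose f h := (upd h k None, h k == Some true).
rewrite -(card_in_imset (f := f)).
  apply/subset_leq_card/subsetP=> _ /imsetP[h hA ->].
  move: hA; rewrite inE => /andP[/dirsP[hL ho h2] kw].
  have ko := walls_neq_o ho kw; have [hk kL] := wallsP _ _ kw.
  rewrite !inE ko kL upd_other 1?eq_sym // ho eqxx upd_same /=.
  by rewrite card_zeros_upd_None // h2.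
move=> h1 h2; rewrite !inE => /andP[_ /andP[k1 _]] /andP[_ /andP[k2 _]] [E Ek].
apply: upd_inj_zero E; move: k1 k2 Ek.
by case: (h1 k) (h2 k) => [[]|] [[]|].
Qed.

(** Each line has two opposite directions. *)
Lemma card_dirs3 n : #|I| = n.+1 -> (n * n.-1 <= #|dirs 3|)%N.
Proof.
move=> In.
pose P := [set Z : {set I} | (o \in Z) && (#|Z| == 3)].
have -> : (#|dirs 3| = \sum_(Z in P) #|[set t in L | zeros t == Z]|)%N.
  rewrite -sum1_card (partition_big zeros (mem P)) /=; last first.
    by move=> t /dirsP[_ to t3]; rewrite !inE to t3 eqxx.
  apply: eq_bigr => Z; rewrite inE => /andP[oZ /eqP Z3].
  rewrite -sum1_card; apply: eq_bigl => t; rewrite !inE.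
  case: (eqVneq (zeros t) Z) => [E|]; rewrite ?andbF // !andbT E Z3 eqxx andbT.
  by move: oZ; rewrite -E in_zeros => ->; rewrite andbT.
rewrite (eq_bigr (fun=> 2)); last first.
  by move=> Z; rewrite inE => /andP[_ /eqP Z3]; rewrite card_vertices.
rewrite sum_nat_const.
have -> : (n * n.-1 = 'C(n, 2) * 2)%N.
  by rewrite bin2 muln2 -[LHS]odd_double_half oddM; case: n {In} => //= n; rewrite andNb.
rewrite leq_mul2r /=.
have <- : #|[set A : {set I} | A \subset [set~ o] & #|A| == 2]| = 'C(n, 2).
  by rewrite cards_draws cardsC1 In.
rewrite -(card_in_imset (f := fun A : {set I} => o |: A)).
  apply/subset_leq_card/subsetP=> _ /imsetP[A + ->]; rewrite !inE.
  move=> /andP[/subsetP Ao /eqP A2]; rewrite eqxx cardsU1 A2.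
  by case oA: (o \in A) => //; move/Ao: oA; rewrite !inE eqxx.
move=> A B; rewrite !inE => /andP[/subsetP Ao _] /andP[/subsetP Bo _] E.
apply/setP=> i; case: (eqVneq i o) => [->|io].
  by apply/idP/idP => [/Ao|/Bo]; rewrite !inE eqxx.
by move/setP: E => /(_ i); rewrite !inE (negPf io).
Qed.

(** The faces at finite distance; the number of zeros is the codimension. *)
Definition aff (z : nat) := [set t in L | (t o == Some true) && (#|zeros t| == z)].

(** Conformity of an affine face [t] and a face [g] at infinity: [t] is a face
    of [lift g]. *)
Definition inc t g :=
  [forall j, (j != o) ==> ((t j == None) || (t j == g j))].

Definition fac (z : nat) g := [set t in aff z | inc t g].

Lemma affP z t :
  reflect [/\ t \in L, t o = Some true & #|zeros t| = z] (t \in aff z).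
Proof. by rewrite !inE; apply: (iffP and3P) => -[? /eqP ? /eqP ?]. Qed.

Lemma incP t g :
  reflect (forall j, j != o -> t j = None \/ t j = g j) (inc t g).
Proof.
apply: (iffP forallP) => H j.
  by move=> jo; move: (H j); rewrite jo => /orP[]/eqP; auto.
by apply/implyP=> /H[] ->; rewrite eqxx ?orbT.
Qed.

Lemma dirs1P g : reflect [/\ g \in L, g o = None & forall j, j != o -> g j != None]
  (g \in dirs 1).
Proof.
apply: (iffP (dirsP 1 g)) => [[gL go g1]|[gL go gn]]; split=> //.
  move=> j; apply: contra; rewrite -in_zeros -in_set1.
  suff -> : zeros g = [set o] by [].
  by apply/esym/eqP; rewrite eqEcard g1 cards1 sub1set in_zeros go eqxx.
suff -> : zeros g = [set o] by rewrite cards1.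
apply/setP=> j; rewrite !inE; case: (eqVneq j o) => [->|jo]; first by rewrite go.
by rewrite (negPf (gn j jo)).
Qed.

(** The planes in [M] are removed one at a time: the faces on the side of [s] of
    the removed plane are counted by the same formula with this plane in [E]. *)
Lemma euler_avoid (E M : {set I}) s : s \in L -> o \in E ->
  (forall j, s j != None) ->
  \sum_(t in L | agree E s t && [forall k in M, t k != s k]) (-1) ^+ #|zeros t|
  = (M == set0)%:R :> int.
Proof.
move=> sL + sn; have [m] := ubnP #|M|.
elim: m M E => // m IHm M E lem oE.
have [->|[k kM]] := set_0Vmem M.
  rewrite eqxx; transitivity ((-1) ^+ #|E :&: zeros s| : int).
    rewrite -(@euler_agree E s o) //; apply: eq_bigl => t.
    suff -> : [forall k in set0, t k != s k] by rewrite andbT.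
    by apply/forall_inP => k; rewrite inE.
  rewrite [_ :&: _](_ : _ = set0) ?cards0 //; apply/setP=> j.
  by rewrite !inE (negPf (sn j)) andbF.
have M0 : M != set0 by apply: contraTneq kM => ->; rewrite inE.
rewrite (negPf M0).
have lem' : (#|M :\ k| < m)%N by move: lem; rewrite (cardsD1 k) kM.
have H1 := IHm _ E lem' oE; have H2 := IHm _ (k |: E) lem' (setU1r _ oE).
transitivity ((M :\ k == set0)%:R - (M :\ k == set0)%:R : int); last exact: subrr.
rewrite -[X in X - _]H1 -H2 [X in X - _](bigID (fun t => t k == s k)) /= addrAC -[LHS]add0r.
congr (_ + _).
  apply/esym/eqP; rewrite subr_eq0; apply/eqP/eq_bigl => t.
  by rewrite agreeU1; case: (t \in L) => //=; rewrite andbAC.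
apply: eq_bigl => t; rewrite -!andbA; do 2 congr (_ && _).
apply/forall_inP/andP => [H|[/forall_inP H tk] i iM].
  split; last exact: H.
  by apply/forall_inP => i; rewrite !inE => /andP[_ /H].
by case: (eqVneq i k) => [->//|ik]; apply: H; rewrite !inE ik.
Qed.

(** Euler's relation for an unbounded cell. The complement of the cell is the
    union of the half-spaces that its planes bound on the other side; since
    any of these half-spaces have a common point, namely every distant point in
    the direction opposite to [g], inclusion and exclusion applies. *)
Lemma euler_cell g : g \in dirs 1 -> (1 + #|fac 2 g| = #|fac 1 g| + #|fac 3 g|)%N.
Proof.
case/dirs1P => gL go gn.
pose s := lift (opp g).
have so : s o = Some true by rewrite upd_same.
have sj j : j != o -> s j = neg_sign (g j) by move=> jo; rewrite upd_other // oppE.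
have sL : s \in L by apply: lift_cov; rewrite ?oppE ?go // (opp_cov HL).
have := @euler_avoid [set o] [set~ o] s sL (set11 o).
have [|j jo] := @ex_notin [set o]; first by rewrite cards1; apply: leq_trans cardI.
rewrite [_ == set0](_ : _ = false); last first.
  by apply/negbTE/set0Pn; exists j; rewrite inE.
have sn i : s i != None.
  by case: (eqVneq i o) => [->|io]; rewrite ?so // sj // neg_sign_None gn.
move=> /(_ sn).
rewrite (eq_bigl (fun t => (t \in L) && ((t o == Some true) && inc t g))); last first.
  move=> t; congr (_ && (_ && _)).
    apply/agreeP/eqP => [|to k]; first by move=> /(_ _ (set11 o)) ->.
    by rewrite inE => /eqP->; rewrite so.
  apply/forall_inP/incP => H i.
    move=> io; move: (H i); rewrite !inE io sj // => /(_ isT).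
    by case: (t i) (g i) (gn i io) => [[]|] [[]|]; auto.
  rewrite !inE => io; rewrite sj //; case: (H i io) => ->; first by rewrite eq_sym neg_sign_None gn.
  by rewrite eq_sym neg_sign_eq gn.
rewrite alternating_sum.
have nE z : ncov z (fun t => (t o == Some true) && inc t g) = #|fac z g|.
  by apply: eq_card => t; rewrite !inE -!andbA; do 2 congr (_ && _); rewrite andbC.
rewrite !nE [#|fac 0 g|](_ : _ = 1%N); first lia.
apply/eqP/cards1P; exists (lift g); apply/setP=> t; rewrite in_set1 inE.
apply/andP/eqP => [[/affP[tL to t0] /incP H]|->].
  apply/ffunP=> i; rewrite updE; case: (eqVneq i o) => [->//|io].
  case: (H i io) => // ti; move/eqP: t0; rewrite cards_eq0 => /eqP/setP/(_ i).
  by rewrite !inE ti.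
split; last by apply/incP=> i io; right; rewrite upd_other.
apply/affP; split; rewrite ?upd_same //; first exact: lift_cov.
apply/eqP; rewrite cards_eq0; apply/eqP/setP=> i; rewrite !inE updE.
by case: (eqVneq i o) => // io; apply/negbTE/gn.
Qed.

(** * Incidences of bounded faces and unbounded cells *)

Lemma card_sep (T : finType) (A : {set T}) (P : pred T) :
  (#|[set x in A | P x]| = \sum_(x in A) P x)%N.
Proof. by rewrite -sum1dep_card big_mkcondr. Qed.

(** In a cell every vertex has three edges, while a bounded edge has two
    vertices and an unbounded edge has one. *)
Lemma fac_vertices g : g \in dirs 1 ->
  (3 * #|fac 3 g| + #|[set e in fac 2 g | o \in walls e]| <= 2 * #|fac 2 g|)%N.
Proof.
case/dirs1P => gL go gn.
have -> : (2 * #|fac 2 g| = \sum_(e in fac 2 g) #|walls e|)%N.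
  rewrite mulnC -sum_nat_const; apply: eq_bigr => e; rewrite inE => /andP[/affP[eL _ e2] _].
  by rewrite card_edge_walls.
rewrite card_sep [X in (_ <= X)%N](eq_bigr (fun e : signvec =>
  (o \in walls e) + #|walls e :\ o|)%N); last first.
  by move=> e _; rewrite (cardsD1 o).
rewrite big_split /= addnC leq_add2l.
have -> : (3 * #|fac 3 g| = \sum_(v in fac 3 g) #|zeros v|)%N.
  rewrite mulnC -sum_nat_const; apply: eq_bigr => v; rewrite inE => /andP[/affP[]//].
rewrite !sum_card_swap; apply: leq_sum => k _.
set A := [set v in fac 3 g | k \in zeros v].
rewrite -[#|A|](card_in_imset (f := fun v => upd v k (g k))); last first.
  move=> v w; rewrite !in_set => /andP[_ /eqP vk] /andP[_ /eqP wk].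
  by apply: upd_inj_zero; rewrite vk wk.
apply/subset_leq_card/subsetP=> _ /imsetP[v + ->].
move=> /setIdP[/setIdP[/affP[vL vo v3] /incP vg]]; rewrite in_zeros => /eqP vk.
have ko : k != o by apply/eqP=> E; move: vo; rewrite -E vk.
rewrite in_set in_set in_setD1 ko /=; apply/andP; split; last first.
  by apply/wallsP; rewrite upd_same upd_upd gn // -vk upd_id.
apply/andP; split; last first.
  by apply/incP=> j jo; rewrite updE; case: eqP => [->|_]; [right|exact: vg].
apply/affP; split; first exact: (upd_cov HL).
  by rewrite upd_other // eq_sym.
case E: (g k) (gn k ko) => [b|//] _.
by apply/eqP; rewrite -eqSS card_zeros_upd_Some // v3.
Qed.

(** The unbounded cells at the face [t], represented by their directions. *)
Definition ucells t := [set g in dirs 1 | inc t g].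

(** The unbounded facets at the face [t], likewise. *)
Definition ufacets t := [set h in dirs 2 | inc t h].

Lemma sum_fac_swap (z z' : nat) (P : pred signvec) :
  (\sum_(g in dirs z') #|[set t in fac z g | P t]| =
   \sum_(t in aff z | P t) #|[set g in dirs z' | inc t g]|)%N.
Proof.
rewrite sum_card_swap [RHS]big_mkcond /=; apply: eq_bigr => t _.
case: ifP => tP.
  case/andP: tP => ta Pt; apply: eq_card => g; rewrite in_set [RHS]in_set.
  by congr (_ && _); rewrite in_set Pt andbT in_set ta.
apply/eqP; rewrite cards_eq0 -subset0; apply/subsetP=> g.
by case/setIdP=> _ /setIdP[/setIdP[ta _] Pt]; rewrite ta Pt in tP.
Qed.

Lemma ucells_form t g k : inc t g -> g o = None -> t k = None -> k != o ->
  (forall j, j != o -> j != k -> t j != None) ->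
  g = upd (upd t o None) k (g k).
Proof.
move=> /incP tg go tk ko tn; apply/ffunP=> j; rewrite !updE.
case: (eqVneq j k) => [->//|jk]; case: (eqVneq j o) => [->//|jo].
by case: (tg j jo) (tn j jo jk) => [->//|->].
Qed.

Lemma aff1P t : t \in aff 1 -> exists k, [/\ k != o, t k = None &
  forall j, j != k -> t j != None].
Proof.
case/affP => tL to /eqP/cards1P[k tk]; exists k; split.
- apply: contraTneq (set11 k) => ko; rewrite -tk in_zeros ko to //.
- by apply/eqP; rewrite -in_zeros tk set11.
- by move=> j; rewrite -in_zeros tk inE.
Qed.

Lemma card_ucells1 t : t \in aff 1 -> (#|ucells t| <= 2)%N.
Proof.
case/aff1P => k [ko tk tn].
apply: leq_trans (subset_leq_card _) (_ : #|[set upd (upd t o None) k (Some true);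
   upd (upd t o None) k (Some false)]| <= 2)%N; last by rewrite cards2; case: (_ != _).
apply/subsetP=> g; rewrite inE => /andP[/dirs1P[gL go gn] tg]; rewrite !inE.
rewrite (@ucells_form _ _ _ tg go tk ko); last by move=> j _; apply: tn.
by case: (g k) (gn k ko) => [[]|]; rewrite // eqxx ?orbT.
Qed.

(** If both cells at a facet contained a direction, a segment between these two
    directions would contain a direction of the facet. *)
Lemma card_ucells1_bounded t : t \in aff 1 -> o \notin walls t -> (#|ucells t| <= 1)%N.
Proof.
move=> ta; rewrite inE => tw; rewrite leqNgt; apply: contra tw => /card_gt1P.
case=> g [g' [/setIdP[/dirs1P[gL go gn] tg] /setIdP[/dirs1P[g'L g'o g'n] tg'] gg']].
have [k [ko tk tn]] := aff1P ta; have [tL to _] := affP _ _ ta.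
have tn' j : j != o -> j != k -> t j != None by move=> _; apply: tn.
rewrite to /=.
have E := ucells_form tg go tk ko tn'.
have E' := ucells_form tg' g'o tk ko tn'.
have gk : g k != g' k by apply: contraNneq gg' => gk; rewrite E E' gk.
have [|q] := @ex_notin [set o; k]; first by rewrite cards2 eq_sym ko; apply: leq_trans cardI.
rewrite !inE negb_or => /andP[qo qk].
have gq : g q = g' q by rewrite E E' !(upd_other _ _ qk).
have [u uL [uk us]] := elim_cov HL gL g'L gq (gn q qo) (signs_neq (gn k ko) (g'n k ko) gk).
suff -> : upd t o None = u by [].
apply/ffunP=> j; case: (eqVneq j k) => [->|jk]; first by rewrite upd_other // uk.
rewrite us; first by rewrite E (upd_other _ _ jk).
by rewrite E E' !(upd_other _ _ jk).
Qed.

Lemma card_unbounded_facets : (#|[set t in aff 1 | o \in walls t]| <= #|dirs 2|)%N.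
Proof.
rewrite -(card_in_imset (f := fun t => upd t o None)); last first.
  move=> s t; rewrite !in_set => /andP[/and3P[_ /eqP so _] _] /andP[/and3P[_ /eqP to _] _].
  by apply: upd_inj_zero; rewrite so to.
apply/subset_leq_card/subsetP=> _ /imsetP[t + ->].
rewrite in_set => /andP[/affP[tL to t1] /wallsP[tn tw]].
by apply/dirsP; split; rewrite ?upd_same ?card_zeros_upd_None ?t1.
Qed.

Lemma card_unbounded_edges : (#|dirs 3| <= #|[set t in aff 2 | o \in walls t]|)%N.
Proof.
rewrite -(card_in_imset (f := lift)); last first.
  move=> s t; rewrite !in_set => /and3P[_ /eqP so _] /and3P[_ /eqP to _].
  by apply: upd_inj_zero; rewrite so to.
apply/subset_leq_card/subsetP=> _ /imsetP[t /dirsP[tL to t3] ->].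
rewrite in_set; apply/andP; split.
  apply/affP; split; [exact: lift_cov|exact: upd_same|].
  by apply/eqP; rewrite -eqSS card_zeros_upd_Some // t3.
by apply/wallsP; split; rewrite ?upd_same // /lift upd_upd -to upd_id.
Qed.

Lemma card_bool2 (P : pred (bool * bool)) : #|[set p | P p]| =
  (P (true, true) + P (true, false) + P (false, true) + P (false, false))%N.
Proof.
rewrite -sum1dep_card big_mkcond /=.
transitivity (\sum_(a : bool) \sum_(b : bool) P (a, b))%N.
  by rewrite pair_bigA; apply: eq_bigr => -[a b].
by rewrite !big_bool /= !addnA.
Qed.

(** The candidates for the traces at infinity of the nine faces around the edge
    [e], which lies on the planes [i] and [j]. *)
Definition around e i j c c' := upd (upd (upd e o None) i c) j c'.

Lemma aff2P e : e \in aff 2 -> exists i j, [/\ i != o, j != o, i != j,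
  e i = None /\ e j = None & forall k, k != i -> k != j -> e k != None].
Proof.
case/affP => eL eo /eqP/cards2P[i [j [ij eij]]]; exists i, j.
have ei : e i = None by apply/eqP; rewrite -in_zeros eij !inE eqxx.
have ej : e j = None by apply/eqP; rewrite -in_zeros eij !inE eqxx orbT.
split=> //.
- by apply: contraTneq isT => io; move: eo; rewrite -io ei.
- by apply: contraTneq isT => jo; move: eo; rewrite -jo ej.
- by move=> k ki kj; rewrite -in_zeros eij !inE negb_or ki.
Qed.

Section Around.
Variables (e : signvec) (i j : I).
Hypotheses (io : i != o) (jo : j != o) (ij : i != j)
  (ei : e i = None) (ej : e j = None)
  (en : forall k, k != i -> k != j -> e k != None).

Lemma aroundE c c' k : around e i j c c' k =
  if k == j then c' else if k == i then c else if k == o then None else e k.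
Proof. by rewrite !updE. Qed.

Lemma around_None : around e i j None None = upd e o None.
Proof.
apply/ffunP=> k; rewrite aroundE updE.
case: (eqVneq k j) => [->|_]; first by rewrite (negPf jo) ej.
by case: (eqVneq k i) => [->|_] //; rewrite (negPf io) ei.
Qed.

Lemma around_form g : inc e g -> g o = None -> g = around e i j (g i) (g j).
Proof.
move/incP=> eg go; apply/ffunP=> k; rewrite aroundE.
case: (eqVneq k j) => [->//|kj]; case: (eqVneq k i) => [->//|ki].
case: (eqVneq k o) => [->//|ko].
by case: (eg k ko) (en ki kj) => [->//|->].
Qed.

Lemma inc_around c c' : inc e (around e i j c c').
Proof.
apply/incP=> k ko; rewrite aroundE (negPf ko).
by case: eqP => [->|_]; [left|case: eqP => [->|_]; [left|right]].
Qed.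

Lemma card_ucells_ge :
  (#|[set p : bool * bool | around e i j (Some p.1) (Some p.2) \in L]| <= #|ucells e|)%N.
Proof.
pose f (p : bool * bool) := around e i j (Some p.1) (Some p.2).
rewrite -(card_in_imset (f := f)); last first.
  move=> [a b] [a' b'] _ _ /ffunP E.
  move: (E i) (E j); rewrite !aroundE !eqxx (negPf ij) => /= -[->] -[->] //.
apply/subset_leq_card/subsetP=> _ /imsetP[p + ->]; rewrite inE => pL.
rewrite in_set inc_around andbT; apply/dirs1P; split=> //.
  by rewrite aroundE eq_sym (negPf jo) eq_sym (negPf io) eqxx.
move=> k ko; rewrite aroundE; case: (eqVneq k j) => // kj.
by case: (eqVneq k i) => // ki; rewrite (negPf ko); apply: en.
Qed.

Lemma card_ufacets_le :
  (#|ufacets e| <= #|[set p : bool * bool |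
     if p.1 then around e i j (Some p.2) None \in L
     else around e i j None (Some p.2) \in L]|)%N.
Proof.
pose f (p : bool * bool) :=
  if p.1 then around e i j (Some p.2) None else around e i j None (Some p.2).
apply: leq_trans (leq_imset_card f _); apply/subset_leq_card/subsetP=> h.
rewrite in_set => /andP[/dirsP[hL ho h2] eh].
have hE := around_form eh ho.
have Z : #|zeros h :\ o| = 1%N by move: h2; rewrite (cardsD1 o) in_zeros ho => -[].
have [hi|hi] := eqVneq (h i) None; have [hj|hj] := eqVneq (h j) None.
- suff : (1 < #|zeros h :\ o|)%N by rewrite Z.
  by apply/card_gt1P; exists i, j; rewrite !inE hi hj io jo.
- case E: (h j) hj => [b|//] _.
  have hF : h = f (false, b) by rewrite {1}hE hi E.
  by rewrite {1}hF; apply: imset_f; rewrite inE /= -[around _ _ _ _ _]/(f (false, b)) -hF.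
- case E: (h i) hi => [b|//] _.
  have hF : h = f (true, b) by rewrite {1}hE hj E.
  by rewrite {1}hF; apply: imset_f; rewrite inE /= -[around _ _ _ _ _]/(f (true, b)) -hF.
suff Z0 : zeros h :\ o = set0 by move: Z; rewrite Z0 cards0.
apply/setP=> k; rewrite !inE; apply/negP=> /andP[ko /eqP hk].
have ki : k != i by apply: contraNneq hi => <-; rewrite hk.
have kj : k != j by apply: contraNneq hj => <-; rewrite hk.
by have [|] := incP _ _ eh k ko; rewrite ?hk => /eqP; rewrite (negPf (en ki kj)).
Qed.

Lemma around_upd1 c c' : around e i j None c' \in L -> around e i j c c' \in L.
Proof.
move=> H; have -> : around e i j c c' = upd (around e i j None c') i c.
  by apply/ffunP=> k; rewrite updE !aroundE; case: (eqVneq k i) => // ->; rewrite (negPf ij).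
by apply: (upd_cov HL) => //; rewrite aroundE (negPf ij) eqxx.
Qed.

Lemma around_upd2 c c' : around e i j c None \in L -> around e i j c c' \in L.
Proof.
move=> H; rewrite /around -(upd_upd _ j None); apply: (upd_cov HL) => //.
by rewrite upd_same.
Qed.

(** Two opposite faces around the edge, both unbounded, would make the edge
    unbounded. *)
Lemma around_elim c c' d d' : around e i j c c' \in L -> around e i j d d' \in L ->
  d = neg_sign c -> d' = neg_sign c' -> (c == None) || (c' == None) ->
  around e i j None None \in L.
Proof.
move=> cL dL Ed Ed' cc'.
have [|k] := @ex_notin [set o; i; j].
  by apply: leq_trans cardI; rewrite setUC cardsU1 cards2; case: (_ \notin _); case: (_ != _).
rewrite !inE !negb_or -andbA => /and3P[ko ki kj].
have E b b' : around e i j b b' k = e k by rewrite aroundE (negPf ko) (negPf ki) (negPf kj).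
pose m := if c == None then j else i.
have [|||u uL [um us]] := @elim_cov _ HL _ _ m k cL dL.
- by rewrite !E.
- by rewrite E en.
- by rewrite /m; case: ifP => _; rewrite !aroundE ?eqxx ?(negPf ij).
have uj : u j = None.
  move: um cc'; rewrite /m; case: (eqVneq c None) => [_ //|_] _ /= /eqP c'0.
  by rewrite us !aroundE eqxx // Ed' c'0.
have ui : u i = None.
  move: um; rewrite /m; case: (eqVneq c None) => [c0 _|_ //].
  by rewrite us !aroundE eqxx (negPf ij) ?c0 // Ed c0.
suff -> : around e i j None None = u by [].
apply/ffunP=> l; rewrite aroundE; case: (eqVneq l j) => [->//|lj].
case: (eqVneq l i) => [->//|li].
by rewrite us !aroundE (negPf lj) (negPf li).
Qed.

(** Both cells at an unbounded facet are unbounded. At a bounded edge two opposite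
    facets cannot both be unbounded; so there is at most one unbounded facet, with
    two unbounded cells, or there are two adjacent ones, with three. *)
Lemma ufacets_ucells : around e i j None None \notin L ->
  (3 * #|ufacets e| <= 2 * #|ucells e|)%N.
Proof.
move=> n00.
apply: leq_trans (leq_mul (leqnn 3) card_ufacets_le) _.
apply: leq_trans _ (leq_mul (leqnn 2) card_ucells_ge).
rewrite !card_bool2 /=.
have A (b b' : bool) : (around e i j None (Some b) \in L) ==> (around e i j (Some b') (Some b) \in L).
  by apply/implyP; apply: around_upd1.
have B (b b' : bool) : (around e i j (Some b) None \in L) ==> (around e i j (Some b) (Some b') \in L).
  by apply/implyP; apply: around_upd2.
have C : ~~ ((around e i j None (Some true) \in L) && (around e i j None (Some false) \in L)).
  by apply: contra n00 => /andP[H1 H2]; apply: around_elim H1 H2 _ _ _.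
have D : ~~ ((around e i j (Some true) None \in L) && (around e i j (Some false) None \in L)).
  by apply: contra n00 => /andP[H1 H2]; apply: around_elim H1 H2 _ _ _.
move: (A true true) (A true false) (A false true) (A false false)
  (B true true) (B true false) (B false true) (B false false) C D.
by do 8!case: (_ \in L).
Qed.

End Around.

Lemma aff_unbounded z t : t \in aff z -> (o \in walls t) = (upd t o None \in L).
Proof. by case/affP=> _ to _; rewrite inE to. Qed.

(** A bounded wall of the unbounded facet [h] is a bounded edge at which [h] is an
    unbounded facet. *)
Lemma sum_bwalls_le :
  (\sum_(h in dirs 2) #|bwalls h| <=
   \sum_(e in aff 2 | o \notin walls e) #|ufacets e|)%N.
Proof.
rewrite -(@sum_fac_swap 2 2 (fun e => o \notin walls e)); apply: leq_sum => h /dirsP[hL ho h2].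
have GL := lift_cov hL ho.
rewrite -[X in (X <= _)%N](card_in_imset (f := fun j => upd (lift h) j None)).
  apply/subset_leq_card/subsetP=> _ /imsetP[j /setDP[/wallsP[Gj jL]]] + ->.
  rewrite in_setU1 negb_or => /andP[jo jw].
  have ea : upd (lift h) j None \in aff 2.
    apply/affP; split=> //; first by rewrite upd_other ?upd_same // eq_sym.
    rewrite card_zeros_upd_None //; apply: (etrans _ h2).
    exact: (@card_zeros_upd_Some h o true).
  rewrite in_set in_set ea /= (aff_unbounded ea); apply/andP; split.
    by apply/incP=> k ko; rewrite updE; case: eqP => _; [left|right; rewrite upd_other].
  have hj : h j != None by move: Gj; rewrite upd_other.
  move: jw; rewrite inE hj /=; apply: contra.
  by rewrite updC // upd_upd -{1}ho upd_id.
move=> j k /setDP[/wallsP[Gj _] _] /setDP[/wallsP[Gk _] _] /ffunP/(_ j).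
rewrite upd_same updE; case: eqP => // _ /esym/eqP.
by rewrite (negPf Gj).
Qed.

(** All four cells at an unbounded edge are unbounded. *)
Lemma card_unbounded_ucells :
  (4 * #|dirs 3| <= \sum_(e in aff 2 | o \in walls e) #|ucells e|)%N.
Proof.
apply: leq_trans (leq_mul (leqnn 4) card_unbounded_edges) _.
rewrite -sum1_card big_distrr /= big_set /=.
rewrite (eq_bigl (fun e => (e \in aff 2) && (o \in walls e))) //.
apply: leq_sum => e /andP[ea ew].
have [i [j [io jo ij [ei ej] en]]] := aff2P ea.
apply: leq_trans _ (card_ucells_ge io jo ij ei ej en).
rewrite card_bool2 /=.
have H c c' : around e i j c c' \in L.
  apply: (around_upd1 ij); apply: around_upd2.
  by rewrite around_None // -(aff_unbounded ea).
by rewrite !H.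
Qed.

(** The facets that do not reach infinity but bound a cell that does. *)
Definition external := [set t in aff 1 |
  (o \notin walls t) && [exists g in dirs 1, inc t g]].

Lemma sum_external :
  (\sum_(t in aff 1 | o \notin walls t) #|ucells t| <= #|external|)%N.
Proof.
have -> : external =
    [set t in [set t in aff 1 | o \notin walls t] | [exists g in dirs 1, inc t g]].
  by apply/setP=> t; rewrite !in_set andbA.
rewrite card_sep [in leqRHS](eq_bigl (fun t => (t \in aff 1) && (o \notin walls t))); last first.
  by move=> t; rewrite in_set.
apply: leq_sum => t /andP[ta tw].
case: exists_inP => [_|H]; first exact: card_ucells1_bounded.
rewrite leqn0 cards_eq0 -subset0; apply/subsetP=> g /setIdP[g1 tg].
by case: H; exists g.
Qed.

(** The relations [3 F_b + 3 F_u >= 3 + E_b + 2 E_u] of the unbounded cells are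
    added up; each external facet occurs once, being on one unbounded cell. *)
Lemma card_external n : #|I| = n.+1 -> (n * n.-1 + 6 <= 3 * #|external|)%N.
Proof.
move=> In.
have cells : (\sum_(g in dirs 1) (3 + #|[set e in fac 2 g | o \notin walls e]|
    + 2 * #|[set e in fac 2 g | o \in walls e]|) <=
   \sum_(g in dirs 1) (3 * #|[set t in fac 1 g | o \notin walls t]|
    + 3 * #|[set t in fac 1 g | o \in walls t]|))%N.
  apply: leq_sum => g g1.
  have split z : (#|fac z g| = #|[set t in fac z g | o \in walls t]|
       + #|[set t in fac z g | o \notin walls t]|)%N.
    rewrite -[LHS]sum1_card !card_sep -big_split /=.
    by apply: eq_bigr => t _; case: (o \in _).
  have := euler_cell g1; have := fac_vertices g1; rewrite !split; lia.
move: cells; rewrite !big_split /= sum_nat_const !big1_eq.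
rewrite (@sum_fac_swap 2 1 (fun e => o \notin walls e)).
rewrite (@sum_fac_swap 2 1 (fun e => o \in walls e)).
rewrite (@sum_fac_swap 1 1 (fun e => o \notin walls e)).
rewrite (@sum_fac_swap 1 1 (fun e => o \in walls e)) => cells.
have facets : (\sum_(t in aff 1 | o \in walls t) #|ucells t| <= 2 * #|dirs 2|)%N.
  apply: leq_trans _ (leq_mul (leqnn 2) card_unbounded_facets).
  rewrite -sum1_card big_distrr /= big_set /= leq_sum // => t /andP[ta _].
  exact: card_ucells1.
have edges : (3 * \sum_(e in aff 2 | o \notin walls e) #|ufacets e| <=
        2 * \sum_(e in aff 2 | o \notin walls e) #|ucells e|)%N.
  rewrite !big_distrr /=; apply: leq_sum => e /andP[ea ew].
  have [i [j [io jo ij [ei ej] en]]] := aff2P ea.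
  apply: (ufacets_ucells io jo ij ei ej en).
  by rewrite around_None // -(aff_unbounded ea).
(* Faces are counted with one incidence for each unbounded cell that contains
   them: be and ue for edges, bf and uf for facets, bounded and unbounded; w and
   y count the bounded edges of unbounded facets. *)
have tally d1 d2 d3 be ue bf uf w y : (d1 * 3 + be + (ue + (ue + 0)) <=
      bf + (bf + (bf + 0)) + (uf + (uf + (uf + 0))) ->
    uf <= 2 * d2 -> 3 * w <= 2 * be -> y <= w -> 2 * d2 <= 3 * y ->
    d1 + d3 = d2 + 2 -> d2 <= 2 * d3 -> n * n.-1 <= d3 -> 4 * d3 <= ue ->
    bf <= #|external| -> n * n.-1 + 6 <= 3 * #|external|)%N.
  by set N := (n * _)%N; lia.
exact: (tally _ _ _ _ _ _ _ _ _ cells facets edges sum_bwalls_le sum_bwalls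
  euler_dirs card_dirs23 (card_dirs3 In) card_unbounded_ucells sum_external).
Qed.

End SignVectors.

(** * Signs of real numbers, and forms in general position *)

Section Sign.
Variable R : realFieldType.
Implicit Types x y : R.

Definition sgn x : option bool := if x == 0 then None else Some (0 < x).

Definition sg (b : bool) : R := if b then 1 else -1.

Lemma sgn_None x : (sgn x == None) = (x == 0).
Proof. by rewrite /sgn; case: (eqVneq x 0). Qed.

Lemma sgn0 : sgn 0 = None.
Proof. by rewrite /sgn eqxx. Qed.

Lemma sgnP x b : sgn x = Some b <-> 0 < sg b * x.
Proof.
rewrite /sgn /sg; case: b; rewrite ?mul1r ?mulN1r ?oppr_gt0; case: ltgtP => //.
Qed.

Lemma sgnW x b : sgn x = None \/ sgn x = Some b <-> 0 <= sg b * x.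
Proof.
rewrite /sgn /sg; case: b; rewrite ?mul1r ?mulN1r ?oppr_ge0; case: ltgtP => //;
  split; auto; by case.
Qed.

Lemma sgn_sg b : sgn (sg b) = Some b.
Proof. by apply/sgnP; rewrite /sg; case: b; lra. Qed.

Lemma sgnN x : sgn (- x) = neg_sign (sgn x).
Proof. by rewrite /sgn oppr_eq0 oppr_gt0; case: ltgtP. Qed.

Lemma sgnM x y : 0 < x -> sgn (x * y) = sgn y.
Proof. by move=> x0; rewrite /sgn mulf_eq0 gt_eqF // pmulr_rgt0. Qed.

Lemma sgn_add x y : sgn x = sgn y -> sgn (x + y) = sgn x.
Proof.
case E: (sgn x) => [b|] /esym Ey; last first.
  by move/eqP: E; move/eqP: Ey; rewrite !sgn_None => /eqP-> /eqP->; rewrite addr0 sgn0.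
move/sgnP: E; move/sgnP: Ey => yb xb; apply/sgnP; rewrite mulrDr; lra.
Qed.

Definition small (P : R -> Prop) := exists2 e, 0 < e & forall d, 0 < d -> d <= e -> P d.

Lemma small_all (J : finType) (P : J -> R -> Prop) :
  (forall j, small (P j)) -> small (fun d => forall j, P j d).
Proof.
move=> H.
have {}H (s : seq J) : small (fun d => forall j, j \in s -> P j d).
  elim: s => [|j s [e e0 IH]]; first by exists 1.
  have [e' e'0 IH'] := H j; exists (Num.min e e'); first by rewrite lt_min e0.
  move=> d d0; rewrite le_min => /andP[de de'] k.
  by rewrite inE => /orP[/eqP->|ks]; [exact: IH'|exact: IH].
have [e e0 He] := H (enum J); exists e => // d d0 de j.
by apply: He => //; rewrite mem_enum.
Qed.

Lemma small_witness P : small P -> exists2 d, 0 < d & P d.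
Proof. by case=> e e0 He; exists e => //; apply: He. Qed.

Lemma small_sgn x y : x != 0 -> small (fun d => sgn (x + d * y) = sgn x).
Proof.
move=> x0; case E: (sgn x) => [b|]; last by move/eqP: E; rewrite sgn_None (negPf x0).
move/sgnP: E => bx; exists (sg b * x / (2 * (`|y| + 1))).
  by rewrite divr_gt0 // mulr_gt0 // ltr_wpDl.
have y0 : 0 < 2 * (`|y| + 1) by rewrite mulr_gt0 // ltr_wpDl.
move=> d d0; rewrite ler_pdivlMr // => dy; apply/sgnP.
have : `|sg b * (d * y)| <= d * `|y|.
  by rewrite !normrM (gtr0_norm d0) /sg; case: b {bx dy}; rewrite ?normrN normr1 mul1r.
have dy0 : 0 <= d * `|y| by rewrite mulr_ge0 // ltW.
rewrite ler_norml => /andP[H _]; rewrite mulrDr; nra.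
Qed.
End Sign.

Section GeneralPosition.
Variables (R : realFieldType) (I : finType) (f : I -> 'cV[R]_4).
Implicit Types v w : 'rV[R]_4.

Definition lin k v : R := (v *m f k) 0 0.

Definition sgv v : {ffun I -> option bool} := [ffun k => sgn (lin k v)].

Definition covectors : {set {ffun I -> option bool}} :=
  [set s | `[< exists2 v, v != 0 & s = sgv v >]].

Lemma covectorsP s : reflect (exists2 v, v != 0 & s = sgv v) (s \in covectors).
Proof. by rewrite inE; apply: asboolP. Qed.

Lemma sgvE v k : sgv v k = sgn (lin k v).
Proof. by rewrite ffunE. Qed.

Lemma linD k v w : lin k (v + w) = lin k v + lin k w.
Proof. by rewrite /lin mulmxDl mxE. Qed.

Lemma linZ k c v : lin k (c *: v) = c * lin k v.
Proof. by rewrite /lin -scalemxAl mxE. Qed.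

Lemma linN k v : lin k (- v) = - lin k v.
Proof. by rewrite /lin mulNmx mxE. Qed.

Lemma lin0 k : lin k 0 = 0.
Proof. by rewrite /lin mul0mx mxE. Qed.

Hypothesis general : forall Z : {set I}, #|Z| = 4 ->
  forall v, (forall k, k \in Z -> lin k v = 0) -> v = 0.

Lemma solve (Z : {set I}) (c : I -> R) : #|Z| = 4 ->
  exists v, forall k, k \in Z -> lin k v = c k.
Proof.
move=> Z4; pose e (j : 'I_4) := enum_val (cast_ord (esym Z4) j).
pose M : 'M[R]_4 := \matrix_(i, j) f (e j) i 0.
have linM v j : (v *m M) 0 j = lin (e j) v.
  by rewrite /lin !mxE; apply: eq_bigr => i _; rewrite mxE.
have eZ k : k \in Z -> exists j, k = e j.
  move=> kZ; exists (cast_ord Z4 (enum_rank_in kZ k)).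
  by rewrite /e cast_ordK enum_rankK_in.
have Mu : M \in unitmx.
  rewrite -row_free_unit; apply: inj_row_free => v vM; apply: (general Z4) => k.
  by move=> /eZ[j ->]; rewrite -linM vM mxE.
exists ((\row_j c (e j)) *m invmx M) => k /eZ[j ->].
by rewrite -linM mulmxKV // mxE.
Qed.

Hypothesis cardI : (4 <= #|I|)%N.

Lemma extend4 (Z : {set I}) : (#|Z| <= 4)%N -> exists2 Z' : {set I}, Z \subset Z' & #|Z'| = 4.
Proof.
have [m] := ubnP (4 - #|Z|)%N; elim: m Z => // m IHm Z lem Z4.
have [|ZN] := eqVneq #|Z| 4; first by exists Z.
have [|k kZ] := @ex_notin _ Z; first by lia.
have [||Z' ZZ' Z'4] := IHm (k |: Z); rewrite ?cardsU1 ?kZ; [lia|lia|].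
by exists Z' => //; exact: (fintype.subset_trans (finset.subsetUr _ _) ZZ').
Qed.

Lemma card_zeros_sgv v : v != 0 -> (#|zeros (sgv v)| <= 3)%N.
Proof.
move=> v0; rewrite leqNgt; apply: contra v0 => Z3.
have [A AZ A4] : exists2 A : {set I}, A \subset zeros (sgv v) & #|A| = 4.
  have : (0 < #|[set A : {set I} | A \subset zeros (sgv v) & #|A| == 4]|)%N.
    by rewrite cards_draws bin_gt0.
  by case/card_gt0P=> A; rewrite inE => /andP[AZ /eqP]; exists A.
apply/eqP/(general A4) => k /(subsetP AZ).
by rewrite in_zeros sgvE sgn_None => /eqP.
Qed.

(** The forms that vanish at a vector are independent, so there is a vector at
    which one of them has a prescribed value while the others vanish; a small
    multiple of it realizes the perturbation of a zero. A vector on three of the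
    hyperplanes is determined up to a factor by its value at a fourth form. *)
Lemma uniform_covectors : uniform_rank4 covectors.
Proof.
split.
- move=> _ /covectorsP[v v0 ->]; apply/covectorsP; exists (- v); first by rewrite oppr_eq0.
  by apply/ffunP=> k; rewrite oppE !sgvE linN sgnN.
- move=> _ k c /covectorsP[v v0 ->] sk; case: c => [b|]; last first.
    by rewrite -sk upd_id; apply/covectorsP; exists v.
  have [|Z' ZZ' Z'4] := @extend4 (zeros (sgv v)).
    by apply: leq_trans (card_zeros_sgv v0) _.
  have [w Hw] := solve (fun j => if j == k then sg R b else 0) Z'4.
  have kZ : k \in Z' by apply: (subsetP ZZ'); rewrite in_zeros sk.
  have [|d d0 Hd] := @small_witness R (fun d => forall j,
      lin j v != 0 -> sgn (lin j v + d * lin j w) = sgn (lin j v)).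
    apply: small_all => j; case: (eqVneq (lin j v) 0) => [_|jv]; first by exists 1.
    by have [e e0 He] := small_sgn (lin j w) jv; exists e => // *; apply: He.
  have vk : lin k v = 0 by apply/eqP; rewrite -sgn_None -sgvE sk.
  have E : sgv (v + d *: w) = upd (sgv v) k (Some b).
    apply/ffunP=> j; rewrite updE !sgvE linD linZ.
    case: (eqVneq j k) => [->|jk]; first by rewrite vk add0r Hw // eqxx sgnM // sgn_sg.
    case: (eqVneq (lin j v) 0) => [jv|]; last exact: Hd.
    by rewrite Hw ?(negPf jk) ?mulr0 ?addr0 // (subsetP ZZ') // in_zeros sgvE sgn_None jv.
  apply/covectorsP; exists (v + d *: w) => //.
  apply/eqP=> v0'; move/ffunP: E => /(_ k); rewrite upd_same sgvE v0' lin0 sgn0.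
  by [].
- move=> _ _ k j /covectorsP[v v0 ->] /covectorsP[w w0 ->] sj sj0 sk.
  case E: (sgv v k) sk => [b|] sk; last first.
    by exists (sgv v) => //; apply/covectorsP; exists v.
  pose u := (sg R (~~ b) * lin k w) *: v + (sg R b * lin k v) *: w.
  have bv : 0 < sg R b * lin k v by apply/sgnP; rewrite -sgvE.
  have bw : 0 < sg R (~~ b) * lin k w by apply/sgnP; rewrite -sgvE.
  have us l : sgv v l = sgv w l -> sgv u l = sgv v l.
    rewrite !sgvE linD !linZ => Hl.
    by rewrite -(sgnM _ bv) in Hl *; rewrite sgn_add !sgnM // -Hl sgnM.
  exists (sgv u); first last.
    split=> //; apply/eqP; rewrite sgvE sgn_None linD !linZ /sg.
    by case: b {E sk bv bw u us}; apply/eqP; rewrite /=; ring.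
  apply/covectorsP; exists u => //.
  by apply: contraNneq sj0 => u0; rewrite -(us j) // u0 sgvE lin0 sgn0.
- by move=> _ /covectorsP[v v0 ->]; apply: card_zeros_sgv.
- move=> Z Z3; have [|l lZ] := @ex_notin _ Z; first by rewrite Z3.
  have Z4 : #|l |: Z| = 4 by rewrite cardsU1 lZ Z3.
  have [v Hv] := solve (fun j => (j == l)%:R) Z4.
  have v0 : v != 0.
    apply: contraTneq isT => v0; have := Hv l (setU11 _ _).
    by rewrite v0 lin0 eqxx => /eqP; rewrite eq_sym oner_eq0.
  exists (sgv v); first by apply/covectorsP; exists v.
  apply/esym/eqP; rewrite eqEcard Z3 card_zeros_sgv // andbT.
  apply/subsetP=> j jZ; rewrite in_zeros sgvE sgn_None Hv ?setU1r //.
  by rewrite (_ : (j == l) = false) //; apply: contraNF lZ => /eqP<-.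
- move=> _ _ /covectorsP[v v0 ->] /covectorsP[w w0 ->] Zvw Z3.
  have [|l lZ] := @ex_notin _ (zeros (sgv v)); first by rewrite Z3.
  have Z4 : #|l |: zeros (sgv v)| = 4 by rewrite cardsU1 lZ Z3.
  have lv : lin l v != 0 by rewrite -sgn_None -sgvE -in_zeros.
  have lw : lin l w != 0 by rewrite -sgn_None -sgvE -in_zeros -Zvw.
  have vE : v = (lin l v / lin l w) *: w.
    apply/eqP; rewrite -subr_eq0; apply/eqP; apply: (general Z4) => j.
    rewrite linD linN linZ in_setU1 => /orP[/eqP->|jZ]; first by rewrite divfK // subrr.
    have jw : lin j w = 0 by apply/eqP; rewrite -sgn_None -sgvE -in_zeros -Zvw.
    have jv : lin j v = 0 by apply/eqP; rewrite -sgn_None -sgvE -in_zeros.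
    by rewrite jw jv mulr0 subr0.
  set c := _ / _ in vE; have c0 : c != 0 by rewrite mulf_neq0 ?invr_eq0.
  have [cp|cn|/eqP] := ltgtP 0 c; last by rewrite eq_sym (negPf c0).
    by left; apply/ffunP=> j; rewrite vE !sgvE linZ sgnM.
  right; apply/ffunP=> j; rewrite oppE vE !sgvE linZ -sgnN -mulrNN.
  by rewrite sgnM ?oppr_gt0.
Qed.

End GeneralPosition.

(** * Homogeneous coordinates for an arrangement *)

Section Dotp.
Variables (R : realType) (d : nat).
Implicit Types u x y : 'rV[R]_d.

Lemma dotp_mul u x : dotp u x = (x *m u^T) 0 0.
Proof. by rewrite /dotp mxE; apply: eq_bigr => i _; rewrite mxE mulrC. Qed.

Lemma dotpD u x y : dotp u (x + y) = dotp u x + dotp u y.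
Proof. by rewrite !dotp_mul mulmxDl mxE. Qed.

Lemma dotpZ u c x : dotp u (c *: x) = c * dotp u x.
Proof. by rewrite !dotp_mul -scalemxAl mxE. Qed.

Lemma dotpN u x : dotp u (- x) = - dotp u x.
Proof. by rewrite !dotp_mul mulNmx mxE. Qed.

Lemma dotpZl c u x : dotp (c *: u) x = c * dotp u x.
Proof. by rewrite /dotp mulr_sumr; apply: eq_bigr => i _; rewrite mxE mulrA. Qed.

Lemma dotp0 u : dotp u 0 = 0.
Proof. by rewrite dotp_mul mul0mx mxE. Qed.

Lemma dotp_sum u k (F : 'I_k -> 'rV[R]_d) : dotp u (\sum_i F i) = \sum_i dotp u (F i).
Proof. exact: (big_morph (dotp u) (dotpD u) (dotp0 u)). Qed.

Lemma dotp_continuous u : continuous (dotp u : 'rV[R]_d -> R).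
Proof.
apply: continuous_big => [[x y]|i _ x].
  by apply: cvgD; [exact: cvg_fst|exact: cvg_snd].
apply: (@continuousM R _ (fun=> u 0 i) (fun y : 'rV[R]_d => y 0 i)).
  exact: cst_continuous.
exact: coord_continuous.
Qed.
End Dotp.

Section Arrangement.
Variables (R : realType) (n : nat) (a : 'I_n -> 'rV[R]_3) (b : 'I_n -> R).
Implicit Types (x y u : 'rV[R]_3) (i j : 'I_n).
Notation signvec := {ffun option 'I_n -> option bool}.
Implicit Types s t : signvec.

Definition ell i x : R := dotp (a i) x - b i.

(** Homogeneous coordinates: the point [x] is [hom x 1], the direction [u] is
    [hom u 0], and [None] stands for the plane at infinity. *)
Definition hom x (c : R) : 'rV[R]_4 := @row_mx R 1 3 1 x c%:M.

Definition form (k : option 'I_n) : 'cV[R]_4 :=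
  if k is Some i then @col_mx R 3 1 1 (a i)^T (- b i)%:M else @col_mx R 3 1 1 0 1%:M.

Lemma lin_Some i x c : lin form (Some i) (hom x c) = dotp (a i) x - b i * c.
Proof.
rewrite /lin /hom /form (@mul_row_col _ 1 3 1 1) mxE -dotp_mul; congr (_ + _).
by rewrite -scalar_mxM mxE eqxx mulr1n mulrN mulrC.
Qed.

Lemma lin_None x c : lin form None (hom x c) = c.
Proof.
by rewrite /lin /hom /form (@mul_row_col _ 1 3 1 1) mulmx0 add0r mulmx1 mxE eqxx mulr1n.
Qed.

Lemma homP (v : 'rV[R]_4) : exists x c, v = hom x c.
Proof.
exists (@lsubmx _ 1 3 1 v), ((@rsubmx _ 1 3 1 v) 0 0).
by rewrite /hom -mx11_scalar hsubmxK.
Qed.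

Lemma hom_eq0 x c : (hom x c == 0) = (x == 0) && (c == 0).
Proof.
apply/eqP/andP => [|[/eqP-> /eqP->]]; last by rewrite /hom raddf0 row_mx0.
rewrite /hom -(@row_mx0 _ 1 3 1) => /(@eq_row_mx _ 1 3 1)[-> /matrixP/(_ 0 0)].
by rewrite !mxE eqxx mulr1n => ->.
Qed.

Definition sv x : signvec := sgv form (hom x 1).

Definition dv u : signvec := sgv form (hom u 0).

Lemma sv_None x : sv x None = Some true.
Proof. by rewrite sgvE lin_None; apply/sgnP; rewrite mul1r. Qed.

Lemma sv_Some x i : sv x (Some i) = sgn (ell i x).
Proof. by rewrite sgvE lin_Some mulr1. Qed.

Lemma dv_None u : dv u None = None.
Proof. by rewrite sgvE lin_None sgn0. Qed.

Lemma dv_Some u i : dv u (Some i) = sgn (dotp (a i) u).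
Proof. by rewrite sgvE lin_Some mulr0 subr0. Qed.

Notation L := (covectors form).

Lemma dv_cov u : u != 0 -> dv u \in L.
Proof.
by move=> u0; apply/covectorsP; exists (hom u 0) => //; rewrite hom_eq0 eqxx andbT.
Qed.

Lemma cov_point s : s \in L -> s None = Some true -> exists x, s = sv x.
Proof.
move=> /covectorsP[v v0 ->]; have [x [c ->]] := homP v.
rewrite sgvE lin_None => /sgnP; rewrite mul1r => c0.
exists (c^-1 *: x); apply/ffunP=> -[i|]; last first.
  by rewrite sv_None sgvE lin_None; apply/sgnP; rewrite mul1r.
rewrite sv_Some sgvE lin_Some -(@sgnM _ c^-1) ?invr_gt0 //; congr (sgn _).
by rewrite /ell dotpZ; field; lra.
Qed.

Lemma cov_dir s : s \in L -> s None = None -> exists2 u, u != 0 & s = dv u.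
Proof.
move=> /covectorsP[v v0 ->]; have [x [c vE]] := homP v; rewrite vE in v0 *.
rewrite sgvE lin_None => /eqP; rewrite sgn_None => /eqP c0; rewrite c0 in v0 *.
by exists x => //; move: v0; rewrite hom_eq0 eqxx andbT.
Qed.

Local Open Scope classical_set_scope.
Variable H : 'I_n -> set 'rV[R]_3.
Hypothesis HE : forall i, H i = [set x | dotp (a i) x = b i].
Hypothesis simpleH : is_simple H.
Hypothesis n5 : (5 <= n)%N.

Lemma H_ell i x : H i x <-> ell i x = 0.
Proof. by rewrite HE /ell /=; split=> [->|/eqP]; [rewrite subrr|rewrite subr_eq0 => /eqP]. Qed.

(** A common direction of three planes would move their common point. *)
Lemma no_common_direction (J : {set 'I_n}) u : #|J| = 3 ->
  (forall i, i \in J -> dotp (a i) u = 0) -> u = 0.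
Proof.
move=> J3 Hu; case: simpleH => _ /(_ J J3)[p Ep] _.
have pJ i : i \in J -> H i p.
  move=> iJ; have : (\bigcap_(i in [set` J]) H i) p by rewrite Ep.
  exact.
have : (\bigcap_(i in [set` J]) H i) (p + u).
  move=> i /= iJ; have /H_ell := pJ i iJ; rewrite /ell => E; apply/H_ell.
  by rewrite /ell dotpD Hu // addr0.
by rewrite Ep /= => /(canRL (addKr _)); rewrite addNr.
Qed.

(** Four concurrent planes would have two different triples with the same point. *)
Lemma no_four_planes (J : {set 'I_n}) x : #|J| = 4 ->
  (forall i, i \in J -> ell i x = 0) -> False.
Proof.
move=> J4 Hx; have /card_gt1P[i [j [iJ jJ ij]]] : (1 < #|J|)%N by rewrite J4.
have card_rem k : k \in J -> #|J :\ k| = 3.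
  by move=> kJ; move: J4; rewrite (cardsD1 k) kJ => -[].
have cap k : k \in J -> \bigcap_(i in [set` (J :\ k)]) H i = [set x].
  move=> kJ; case: simpleH => _ /(_ _ (card_rem k kJ))[p Ep] _; rewrite Ep.
  have : (\bigcap_(i in [set` (J :\ k)]) H i) x.
    by move=> l /=; rewrite in_setD1 => /andP[_ /Hx/H_ell].
  by rewrite Ep /= => ->.
case: simpleH => _ _ /(_ (J :\ i) (J :\ j)) []; rewrite ?card_rem ?cap //.
move/setP/(_ i); rewrite !in_setD1 eqxx ij iJ; by [].
Qed.

(** Without the plane at infinity, a common zero of four forms is either a point
    common to four planes or a direction common to them; with it, a direction
    common to three planes. *)
Lemma general_position (Z : {set option 'I_n}) : #|Z| = 4 ->
  forall v, (forall k, k \in Z -> lin form k v = 0) -> v = 0.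
Proof.
move=> Z4 v; have [x [c ->]] := homP v => Hv; apply/eqP.
pose J := [set i | Some i \in Z]%SET.
have JE : #|J| = #|Z :\ None|.
  rewrite -(card_imset _ Some_inj); apply: eq_card => -[i|]; last first.
    by rewrite !inE; apply/imsetP => -[].
  rewrite !inE; apply/imsetP/idP => [[j + [->]]|iZ]; first by rewrite inE.
  by exists i; rewrite ?inE.
have HJ i : i \in J -> dotp (a i) x - b i * c = 0.
  by rewrite inE => /Hv; rewrite lin_Some.
have case0 : c = 0 -> (exists2 K : {set 'I_n}, K \subset J & #|K| = 3) -> hom x c == 0.
  move=> c0 [K KJ K3]; rewrite hom_eq0 c0 eqxx andbT; apply/eqP.
  apply: (no_common_direction K3) => i /(subsetP KJ)/HJ.
  by rewrite c0 mulr0 subr0.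
have [NZ|NZ] := boolP (None \in Z).
  have c0 : c = 0 by have := Hv _ NZ; rewrite lin_None.
  apply: case0 => //; exists J => //; rewrite JE.
  by move: Z4; rewrite (cardsD1 None) NZ => -[].
have J4 : #|J| = 4.
  by rewrite JE -Z4 [RHS](cardsD1 None) (negPf NZ).
have [c0|c0] := eqVneq c 0.
  apply: case0 => //.
  have /card_gt0P[i iJ] : (0 < #|J|)%N by rewrite J4.
  exists (J :\ i); first exact: subD1set.
  by move: J4; rewrite (cardsD1 i) iJ => -[].
case: (@no_four_planes J (c^-1 *: x) J4) => i /HJ E.
by rewrite /ell dotpZ; apply: (mulfI c0); rewrite mulr0 -E; field.
Qed.

Lemma card_planes : #|{: option 'I_n}| = n.+1.
Proof. by rewrite card_option card_ord. Qed.

Lemma uniform_arrangement : uniform_rank4 L.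
Proof.
by apply: uniform_covectors; [exact: general_position|rewrite card_planes; lia].
Qed.

(** * Cells as polyhedra *)

Definition weak (c : option bool) (y : R) : Prop :=
  if c is Some c' then 0 <= sg R c' * y else y = 0.

(** The closed polyhedron of the points that satisfy weakly the inequalities and
    equations recorded in [s]: the closure of a face if [s] is the sign vector of a point. *)
Definition polyhedron s : set 'rV[R]_3 := [set x | inc None (sv x) s].

Lemma polyhedronP s x :
  polyhedron s x <-> forall i, weak (s (Some i)) (ell i x).
Proof.
split=> [/incP H1 i|H1].
  have := H1 (Some i) isT; rewrite sv_Some /weak; case: (s _) => [c|]; first exact: (sgnW _ _).1.
  by case=> /eqP; rewrite sgn_None => /eqP.
apply/incP=> -[i|//] _; rewrite sv_Some; have := H1 i; rewrite /weak.
by case: (s _) => [c /(sgnW _ _)|->]; rewrite ?sgn0; auto.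
Qed.

Lemma ell_line i x y d : ell i (x + d *: (y - x)) = ell i x + d * (ell i y - ell i x).
Proof. rewrite /ell dotpD dotpZ dotpD dotpN; ring. Qed.

Lemma ell_shift i x d u : ell i (x + d *: u) = ell i x + d * dotp (a i) u.
Proof. rewrite /ell dotpD dotpZ; ring. Qed.

Lemma ell_continuous i : continuous (ell i : 'rV[R]_3 -> R).
Proof.
move=> x; apply: (@continuousB _ _ _ (dotp (a i)) (fun=> b i)); first exact: dotp_continuous.
exact: cst_continuous.
Qed.

Lemma line_continuous x y : continuous (fun d : R => x + d *: y).
Proof.
move=> d; apply: (@continuousD _ _ _ (fun=> x) (fun d : R => d *: y)).
  exact: cst_continuous.
exact: scalel_continuous.
Qed.

Lemma complementP x : complement H x <-> forall i, sv x (Some i) != None.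
Proof.
split=> [cx i|cx [i _ /H_ell Hix]].
  apply/eqP=> svi; apply: cx; exists i => //; apply/H_ell.
  by apply/eqP; rewrite -sgn_None -sv_Some svi.
by have := cx i; rewrite sv_Some Hix sgn0.
Qed.

Lemma same_sv x y : (forall i, sgn (ell i y) = sgn (ell i x)) -> sv y = sv x.
Proof. by move=> E; apply/ffunP=> -[i|]; rewrite ?sv_None // !sv_Some. Qed.

Lemma sgn_line (p q d : R) : 0 <= d -> d <= 1 -> sgn q = sgn p -> sgn (p + d * (q - p)) = sgn p.
Proof.
move=> d0 d1 E; case Ep: (sgn p) E => [c|] Eq; last first.
  move/eqP: Ep; move/eqP: Eq; rewrite !sgn_None => /eqP-> /eqP->.
  by rewrite subrr mulr0 addr0 sgn0.
move/sgnP: Ep; move/sgnP: Eq => cq cp; apply/sgnP.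
have [->|d1'] := eqVneq d 1; first by rewrite mul1r addrC subrK.
have lt1 : 0 < 1 - d by rewrite subr_gt0 lt_neqAle d1' d1.
have -> : sg R c * (p + d * (q - p)) = (1 - d) * (sg R c * p) + d * (sg R c * q) by ring.
by apply: ltr_wpDr; [rewrite mulr_ge0 // ltW|rewrite mulr_gt0].
Qed.

(** The set is convex, hence a union of segments from [x]. *)
Lemma connected_same_sign x : connected [set y | sv y = sv x].
Proof.
have -> : [set y | sv y = sv x] =
    \bigcup_(y in [set y | sv y = sv x]) ((fun d : R => x + d *: (y - x)) @` `[0, 1]).
  apply/seteqP; split=> [y /= E|y [z /= E [d]]].
    exists y => //; exists 1; first by rewrite /= in_itv /= ler01 lexx.
    by rewrite scale1r addrC subrK.
  rewrite /= in_itv /= => /andP[d0 d1] <-; apply: same_sv => i.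
  rewrite ell_line sgn_line //.
  by move/ffunP: E => /(_ (Some i)); rewrite !sv_Some.
apply: bigcup_connected.
  exists x => y _; exists 0; first by rewrite /= in_itv /= ler01 lexx.
  by rewrite scale0r addr0.
move=> y _; apply: connected_continuous_connected; first exact: segment_connected.
by apply: continuous_subspaceT; apply: line_continuous.
Qed.

(** On a connected set avoiding the planes no affine form changes its sign. *)
Lemma component_same_sign x : complement H x ->
  connected_component (complement H) x = [set y | sv y = sv x].
Proof.
move=> cx; apply/seteqP; split=> [y [C [Cx CH Cc] Cy] /=|]; last first.
  apply: connected_component_max => //; last exact: connected_same_sign.
  by move=> y /= E; apply/complementP; rewrite E; apply/complementP.
apply: same_sv => i; apply/eqP; apply: contraT => ne.
have iC : is_interval (ell i @` C).
  apply/connected_intervalP; apply: connected_continuous_connected => //.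
  by apply: continuous_subspaceT; apply: ell_continuous.
have C0 z : C z -> sgn (ell i z) != None.
  by move=> /CH/complementP/(_ i); rewrite sv_Some.
suff [z Cz z0] : (ell i @` C) 0 by have := C0 z Cz; rewrite z0 sgn0.
have xx := C0 x Cx; have yy := C0 y Cy.
have inx : (ell i @` C) (ell i x) by exists x.
have iny : (ell i @` C) (ell i y) by exists y.
move: ne xx yy; rewrite /sgn.
have [x0|x0|x0] := ltgtP (ell i x) 0; have [y0|y0|y0] := ltgtP (ell i y) 0 => //= _ _ _.
  by apply: (iC _ _ inx iny); rewrite !ltW.
by apply: (iC _ _ iny inx); rewrite !ltW.
Qed.

Lemma polyhedron_closed s : closed (polyhedron s).
Proof.
have -> : polyhedron s = \bigcap_(i in [set: 'I_n]) [set x | weak (s (Some i)) (ell i x)].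
  apply/seteqP; split=> x; first by move/polyhedronP=> H1 i _; apply: H1.
  by move=> H1; apply/polyhedronP=> i; apply: H1.
apply: closed_bigI => i _; rewrite /weak; case: (s _) => [c|].
  apply: (@closed_comp _ _ (fun x => sg R c * ell i x) [set y | 0 <= y]); last exact: closed_ge.
  move=> x _; apply: (@continuousM R _ (fun=> sg R c) (ell i)); first exact: cst_continuous.
  exact: ell_continuous.
apply: (@closed_comp _ _ (ell i) [set y | y = 0]); last exact: closed_eq.
by move=> x _; apply: ell_continuous.
Qed.

Lemma small_closure (S : set 'rV[R]_3) x y :
  small (fun d => S (y + d *: (x - y))) -> closure S y.
Proof.
case=> e e0 He B nB.
have nB0 : nbhs (y + 0 *: (x - y)) B by rewrite scale0r addr0.
have /nbhs_ballP[r /= r0 Br] := @line_continuous y (x - y) 0 B nB0.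
pose d := Num.min e (r / 2).
have d0 : 0 < d by rewrite lt_min e0 divr_gt0.
exists (y + d *: (x - y)); split; first by apply: He => //; rewrite ge_min lexx.
apply: Br; rewrite /ball /= sub0r normrN gtr0_norm //.
by rewrite /d gt_min [X in _ || X]ltr_pdivrMr // ltr_pMr // ltr1n orbT.
Qed.

(** A point of the polyhedron is a limit of the points that lie slightly closer to
    the interior point [x]. *)
Lemma closure_same_sign x : (forall i, sv x (Some i) != None) ->
  closure [set y | sv y = sv x] = polyhedron (sv x).
Proof.
move=> cx; apply/seteqP; split.
  rewrite [X in _ `<=` X]((closure_id _).1 (@polyhedron_closed (sv x))).
  by apply: closureS => y /= E; apply/incP=> k _; rewrite E; right.
move=> y /incP Py; apply: (small_closure (x := x)).
exists 1 => // d d0 d1; apply: same_sv => i; rewrite ell_line.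
have := Py (Some i) isT; rewrite !sv_Some => -[|E]; last by rewrite sgn_line // ltW.
move=> /eqP; rewrite sgn_None => /eqP->; rewrite add0r subr0 sgnM //.
Qed.

Lemma cell_polyhedron x : complement H x ->
  closure (connected_component (complement H) x) = polyhedron (sv x).
Proof.
by move=> cx; rewrite component_same_sign // closure_same_sign //; apply/complementP.
Qed.

(** * Bounded and unbounded cells *)

Local Notation U := uniform_arrangement.

(** The ray from a point of the cell in a direction with the same signs stays in
    the cell. *)
Lemma unbounded_polyhedron s : s \in L -> s None = Some true ->
  upd s None None \in L -> ~ bounded_set (polyhedron s).
Proof.
move=> sL so uL [M [_ HM]]; have [x sE] := cov_point sL so.
have [u u0 uE] := cov_dir uL (upd_same _ _ _).
have uS i : sgn (dotp (a i) u) = s (Some i) by rewrite -dv_Some -uE upd_other.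
pose N := `|M| + 1.
have MN : M < N by rewrite /N (le_lt_trans (ler_norm M)) // ltrDl.
pose d := (N + `|x| + 1) / `|u|.
have nu : 0 < `|u| by rewrite normr_gt0.
have d0 : 0 < d by rewrite divr_gt0 // ltr_pwDr // addr_ge0 // addr_ge0.
have Px : polyhedron s (x + d *: u).
  apply/incP=> -[i|//] _; right; rewrite sv_Some ell_shift.
  have xS : sgn (ell i x) = s (Some i) by rewrite sE sv_Some.
  by rewrite sgn_add // sgnM // uS.
have := HM N MN _ Px; apply/negP; rewrite -ltNge.
have : `|d *: u| <= `|x + d *: u| + `|x|.
  by rewrite -[X in `|X| <= _](addKr x) addrC (le_trans (ler_normD _ _)) // normrN.
by rewrite normrZ gtr0_norm // /d divfK ?gt_eqF //; lra.
Qed.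

(** A direction that satisfies the inequalities weakly can be perturbed to one that
    satisfies them strictly. *)
Lemma dir_of_recession s u : s None = Some true -> (forall i, s (Some i) != None) ->
  u != 0 -> (forall i, weak (s (Some i)) (dotp (a i) u)) -> upd s None None \in L.
Proof.
move=> so sn u0 Hu; have -> : upd s None None = fill (dv u) (upd s None None).
  apply/ffunP=> -[i|]; rewrite fillE ?dv_None ?dv_Some // upd_other //.
  have := Hu i; case E: (s _) (sn i) => [c|//] _ /(sgnW _ _)[->|->] //.
by apply: (fill_cov U); apply: dv_cov.
Qed.

(** If no direction satisfies the inequalities, compactness of the unit sphere
    gives a positive lower bound for the amount by which unit vectors violate
    them; this amount is homogeneous in the vector, and bounded on the cell. *)
Lemma bounded_polyhedron s : s None = Some true -> (forall i, s (Some i) != None) ->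
  upd s None None \notin L -> bounded_set (polyhedron s).
Proof.
move=> so sn uL; pose c i := if s (Some i) is Some c' then sg R c' else 0.
have sE i : exists2 c', s (Some i) = Some c' & c i = sg R c'.
  by rewrite /c; case: (s _) (sn i) => [c'|//] _; exists c'.
pose y i u := c i * dotp (a i) u.
(* Twice the total amount by which u violates the inequalities. *)
pose f u : R := \sum_(i < n) (`|y i u| - y i u).
have y_cont i : continuous (y i).
  move=> u; apply: (@continuousM R _ (fun=> c i) (dotp (a i))); first exact: cst_continuous.
  exact: dotp_continuous.
have f_cont : continuous f.
  apply: continuous_big => [[p q]|i _ u].
    by apply: cvgD; [exact: cvg_fst|exact: cvg_snd].
  apply: (@continuousB _ _ _ (fun u => `|y i u|) (y i)); last exact: y_cont.
  by apply: continuous_comp; [exact: y_cont|exact: norm_continuous].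
have f_term i u : 0 <= `|y i u| - y i u by rewrite subr_ge0 ler_norm.
have f_pos u : u != 0 -> 0 < f u.
  move=> u0; rewrite lt_def sumr_ge0 // andbT; apply: contra uL => /eqP fu0.
  apply: (dir_of_recession so sn u0) => i; have [c' -> ci] := sE i.
  have /psumr_eq0P/(_ fu0 i isT) : forall i, true -> 0 <= `|y i u| - y i u by [].
  by rewrite /weak -ci -/(y i u) => /eqP; rewrite subr_eq0 => /eqP <-.
pose K := [set u : 'rV[R]_3 | `|u| = 1].
have K_norm u : u != 0 -> K (`|u|^-1 *: u).
  move=> u0; rewrite /K /= normrZ ger0_norm ?invr_ge0 // mulVf // normr_eq0 //.
have K_compact : compact K.
  apply: bounded_closed_compact.
    by exists 1; split=> // M M1 u /= ->; apply: ltW.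
  by apply: (@closed_comp _ _ (fun u : 'rV[R]_3 => `|u|) [set r | r = 1]);
    [move=> u _; exact: norm_continuous|exact: closed_eq].
have K0 : K !=set0.
  exists (`|const_mx 1 : 'rV[R]_3|^-1 *: const_mx 1); apply: K_norm.
  by apply/eqP=> /matrixP/(_ 0 0)/eqP; rewrite !mxE oner_eq0.
have [m mK m_min] := compact_EVT_min K0 K_compact (continuous_subspaceT f_cont).
have m0 : 0 < f m.
  apply: f_pos; apply/eqP=> m0; have := set_mem mK; rewrite /K /= m0 normr0 => /eqP.
  by rewrite eq_sym oner_eq0.
have f_scale r u : 0 <= r -> f (r *: u) = r * f u.
  move=> r0; rewrite /f big_distrr /=; apply: eq_bigr => i _.
  by rewrite /y dotpZ mulrCA normrM (ger0_norm r0) mulrBr.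
pose B := \sum_(i < n) (2 * `|b i|).
exists (B / f m); split=> [|M BM x Px]; first exact: num_real.
apply: le_trans (ltW BM); rewrite ler_pdivlMr //.
have [->|x0] := eqVneq x 0; first by rewrite normr0 mul0r sumr_ge0 // => i _; rewrite mulr_ge0.
have nx : 0 < `|x| by rewrite normr_gt0.
apply: le_trans (_ : f x <= _); last first.
  apply: ler_sum => i _; have [c' si ci] := sE i.
  have := (polyhedronP _ _).1 Px i; rewrite si /weak -ci /ell mulrBr -/(y i x).
  have : `|c i * b i| = `|b i|.
    by rewrite ci normrM /sg; case: (c'); rewrite ?normrN normr1 mul1r.
  move=> <-; have := ler_norm (- (c i * b i)); rewrite normrN.
  have := normr_ge0 (c i * b i).
  by have [y0|y0] := lerP 0 (y i x); [rewrite (ger0_norm y0)|rewrite (ltr0_norm y0)]; lra.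
have xE : x = `|x| *: (`|x|^-1 *: x) by rewrite scalerA divff ?gt_eqF // scale1r.
rewrite [in f x]xE f_scale // ler_pM2l //.
by apply: m_min; apply/mem_set; apply: K_norm.
Qed.

(** * External facets *)

Lemma small_and (P Q : R -> Prop) : small P -> small Q -> small (fun d => P d /\ Q d).
Proof.
move=> [e e0 HP] [e' e'0 HQ]; exists (Num.min e e'); first by rewrite lt_min e0.
by move=> d d0; rewrite le_min => /andP[de de']; split; [exact: HP|exact: HQ].
Qed.

Lemma small_pos e : 0 < e -> small (fun d : R => d <= e).
Proof. by exists e. Qed.

Lemma self_polyhedron x : polyhedron (sv x) x.
Proof. by apply/incP=> k _; right. Qed.

Lemma sv_eq0 x i : (sv x (Some i) == None) = (ell i x == 0).
Proof. by rewrite sv_Some sgn_None. Qed.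

Lemma small_move_in_plane x i w : (forall j, j != i -> ell j x != 0) ->
  ell i x = 0 -> dotp (a i) w = 0 -> small (fun d => sv (x + d *: w) = sv x).
Proof.
move=> xn xi wi.
have [e e0 He] : small (fun d => forall j, sgn (ell j x + d * dotp (a j) w) = sgn (ell j x)).
  apply: small_all => j; have [->|ji] := eqVneq j i; last exact/small_sgn/xn.
  by exists 1 => // d _ _; rewrite wi mulr0 addr0.
by exists e => // d d0 de; apply: same_sv => j; rewrite ell_shift He.
Qed.

(** The directions are dual to two further planes, restricted to the plane [i]. *)
Lemma two_plane_directions i : exists w1 w2 : 'rV[R]_3,
  [/\ dotp (a i) w1 = 0, dotp (a i) w2 = 0 & free [:: w1; w2]].
Proof.
have [|j ji] := @ex_notin _ [set i]%SET; first by rewrite cards1 card_ord; lia.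
have [|k] := @ex_notin _ [set i; j]%SET.
  by rewrite cards2 card_ord; case: (_ != _) => /=; lia.
rewrite in_set1 in ji; rewrite in_set2 negb_or => /andP[ki kj].
pose Z : {set option 'I_n} := (None |: (Some i |: [set Some j; Some k]))%SET.
have Z4 : #|Z| = 4.
  rewrite !cardsU1 cards1 !inE !(inj_eq Some_inj).
  by rewrite (eq_sym i j) (eq_sym j k) (eq_sym i k) (negPf ji) (negPf ki) (negPf kj).
have dir c : c None = 0 -> exists w, forall l, Some l \in Z -> dotp (a l) w = c (Some l).
  move=> c0; have [v Hv] := solve general_position c Z4.
  have [w [t vE]] := homP v; rewrite vE in Hv.
  have t0 : t = 0 by have := Hv None; rewrite lin_None c0 !inE; apply.
  by exists w => l lZ; rewrite -(Hv _ lZ) lin_Some t0 mulr0 subr0.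
have [w1 H1] := dir (fun l => (l == Some j)%:R) erefl.
have [w2 H2] := dir (fun l => (l == Some k)%:R) erefl.
have iZ : Some i \in Z by rewrite !inE eqxx.
have jZ : Some j \in Z by rewrite !inE eqxx !orbT.
have kZ : Some k \in Z by rewrite !inE eqxx !orbT.
exists w1, w2; split.
- by rewrite H1 // (inj_eq Some_inj) eq_sym (negPf ji).
- by rewrite H2 // (inj_eq Some_inj) eq_sym (negPf ki).
rewrite free_cons seq1_free span_seq1; apply/andP; split.
  apply/negP => /vlineP[r w1E]; have := H1 j jZ; rewrite w1E dotpZ H2 // eqxx.
  rewrite (inj_eq Some_inj) eq_sym (negPf kj) mulr0 => /eqP.
  by rewrite eq_sym oner_eq0.
apply/eqP=> w20; have := H2 k kZ; rewrite w20 dotp0 eqxx => /eqP.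
by rewrite eq_sym oner_eq0.
Qed.

(** Three independent vectors span the whole space, on which the form does not
    vanish. *)
Lemma free_plane_size i (X : seq 'rV[R]_3) : free X ->
  (forall w, w \in X -> dotp (a i) w = 0) -> (size X <= 2)%N.
Proof.
move=> fX HX; rewrite leqNgt; apply/negP => X3.
have spanT : <<X>>%VS = fullv.
  apply/eqP; rewrite eqEdim subvf /= dimvf (eqP fX).
  by rewrite /dim /= mul1n.
have ker w : dotp (a i) w = 0.
  have : w \in <<X>>%VS by rewrite spanT memvf.
  move/(@coord_span _ _ _ (in_tuple X)) => ->; rewrite dotp_sum big1 // => l _.
  by rewrite dotpZ HX ?mulr0 // mem_nth.
have n4 : (4 <= #|{: option 'I_n}|)%N by rewrite card_planes; lia.
have c2 : (#|[set None; Some i]%SET| <= 4)%N by rewrite cards2.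
have [Z iZ Z4] := extend4 n4 c2.
have [v Hv] := solve general_position (fun k => (k == Some i)%:R) Z4.
have [w [t vE]] := homP v; rewrite vE in Hv.
have NZ : None \in Z by apply: (subsetP iZ); rewrite !inE.
have SZ : Some i \in Z by apply: (subsetP iZ); rewrite !inE eqxx.
have t0 : t = 0 by rewrite -[t](@lin_None w) Hv.
have := Hv _ SZ; rewrite lin_Some ker t0 mulr0 subr0 eqxx => /eqP.
by rewrite eq_sym oner_eq0.
Qed.

Lemma facet_dim x i : ell i x = 0 -> (forall j, j != i -> ell j x != 0) ->
  has_dim (polyhedron (sv x)) 2.
Proof.
move=> xi xn; split; last first.
  move=> p X Pp PX fX; rewrite -(size_map (fun y => y - p)); apply: (@free_plane_size i) => //.
  have P0 y : polyhedron (sv x) y -> ell i y = 0.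
    by move/polyhedronP/(_ i); rewrite sv_Some xi sgn0.
  move=> _ /mapP[y yX ->]; have := P0 y (PX y yX); have := P0 p Pp.
  rewrite /ell dotpD dotpN => /eqP; rewrite subr_eq0 => /eqP -> /eqP.
  by rewrite subr_eq0 => /eqP ->; rewrite subrr.
have [w1 [w2 [w1i w2i fw]]] := two_plane_directions i.
have [d d0 [E1 E2]] := small_witness (small_and (small_move_in_plane xn xi w1i)
  (small_move_in_plane xn xi w2i)).
exists x, [:: x + d *: w1; x + d *: w2]; split=> //.
- exact: self_polyhedron.
- move=> y; rewrite !inE => /orP[]/eqP->; [rewrite -E1|rewrite -E2]; exact: self_polyhedron.
rewrite /= ![x + _]addrC !addrK.
move: fw; rewrite free_cons seq1_free span_seq1 => /andP[w12 w20].
rewrite free_cons seq1_free span_seq1 scaler_eq0 negb_or (gt_eqF d0) w20 /= andbT.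
apply: contra w12 => /vlineP[r E]; apply/vlineP; exists r.
by apply: (scalerI (lt0r_neq0 d0)); rewrite E scalerA mulrC -scalerA.
Qed.

Lemma facet_kface x i c : ell i x = 0 -> (forall j, j != i -> ell j x != 0) ->
  is_kface 2 (polyhedron (upd (sv x) (Some i) (Some c))) (polyhedron (sv x)).
Proof.
move=> xi xn; split; last exact: facet_dim xi xn.
have half y : polyhedron (upd (sv x) (Some i) (Some c)) y -> 0 <= sg R c * ell i y.
  by move/polyhedronP/(_ i); rewrite upd_same.
exists (- sg R c *: a i), (- sg R c * b i); split=> [y /half|].
  by rewrite dotpZl /ell; lra.
apply/seteqP; split=> y.
  move/polyhedronP=> Py; have yi : ell i y = 0 by have := Py i; rewrite sv_Some xi sgn0.
  split; last by move: yi; rewrite /= dotpZl /ell; move/eqP; rewrite subr_eq0 => /eqP->.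
  apply/polyhedronP=> j; rewrite updE (inj_eq Some_inj).
  by case: (eqVneq j i) => [->|_]; [rewrite /weak yi mulr0|exact: Py].
case=> /polyhedronP Py /=; rewrite dotpZl => yi; apply/polyhedronP=> j.
have [->|ji] := eqVneq j i; last by have := Py j; rewrite upd_other // (inj_eq Some_inj).
rewrite sv_Some xi sgn0 /weak /ell; apply/eqP; rewrite subr_eq0; apply/eqP.
by apply: mulfI yi; rewrite oppr_eq0 /sg; case: (c); rewrite ?oppr_eq0 oner_eq0.
Qed.

Lemma cell_of s : s \in L -> s None = Some true -> (forall i, s (Some i) != None) ->
  is_cell H (polyhedron s).
Proof.
move=> sL so sn; have [x sE] := cov_point sL so; exists x.
  by apply/complementP=> i; rewrite -sE.
by rewrite cell_polyhedron ?sE //; apply/complementP=> i; rewrite -sE.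
Qed.

Lemma cellP C : is_cell H C -> exists2 x, complement H x & C = polyhedron (sv x).
Proof. by case=> x cx ->; exists x => //; rewrite cell_polyhedron. Qed.

Notation ext := (external L None).

(** The direction [g] belongs to the cell on one side of the facet. The cell on the
    other side contains no direction, and any cell with this facet is one of the
    two, because it contains a point [p] in the relative interior. *)
Lemma external_polyhedron t : t \in ext -> external_facets H (polyhedron t).
Proof.
rewrite in_set => /andP[ta /andP[tw /exists_inP[g g1 tg]]].
have [k [ko tk tn]] := aff1P ta; have [tL to _] := affP _ _ _ _ ta.
have [i kE] : exists i, k = Some i by case: k ko {tk tn} => // i _; exists i.
subst k.
have [p tE] := cov_point tL to.
have pi : ell i p = 0 by apply/eqP; rewrite -sv_eq0 -tE tk.
have pn j : j != i -> ell j p != 0.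
  by move=> ji; rewrite -sv_eq0 -tE tn // (inj_eq Some_inj).
have [gL go gn] := dirs1P _ _ _ g1.
have gE c : g (Some i) = Some c -> g = upd (upd t (Some i) (Some c)) None None.
  move=> gi; rewrite -gi updC //; apply: ucells_form tg go tk ko _ => j _; exact: tn.
have [c gi] : exists c, g (Some i) = Some c.
  by case: (g _) (gn (Some i) isT) => // c; exists c.
have sL c' : upd t (Some i) (Some c') \in L by apply: (upd_cov U).
have so c' : upd t (Some i) (Some c') None = Some true by rewrite upd_other.
have sn c' j : upd t (Some i) (Some c') (Some j) != None.
  rewrite updE (inj_eq Some_inj); case: (eqVneq j i) => // ji.
  by apply: tn; rewrite (inj_eq Some_inj).
have unb : ~ bounded_set (polyhedron (upd t (Some i) (Some c))).
  by apply: unbounded_polyhedron => //; rewrite -gE.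
have bnd : bounded_set (polyhedron (upd t (Some i) (Some (~~ c)))).
  apply: bounded_polyhedron => //; apply/negP=> hL.
  have n6 : (6 <= #|{: option 'I_n}|)%N by rewrite card_planes.
  have := card_ucells1_bounded U n6 ta tw; rewrite leqNgt => /card_gt1P; apply.
  exists g, (upd (upd t (Some i) (Some (~~ c))) None None); split.
  - by rewrite in_set g1 tg.
  - rewrite in_set; apply/andP; split; last first.
      apply/incP=> k kN; rewrite !updE (negPf kN).
      by case: (eqVneq k (Some i)) => [->|_]; [left|right].
    apply/dirs1P; split=> [||[j|//] _]; [exact: hL|exact: upd_same|].
    by rewrite upd_other.
  apply/eqP=> /ffunP/(_ (Some i)); rewrite gi upd_other // upd_same => -[].
  by case: (c).
have kf c' : is_kface 2 (polyhedron (upd t (Some i) (Some c'))) (polyhedron t).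
  by rewrite tE; apply: facet_kface.
split; first by exists (polyhedron (upd t (Some i) (Some (~~ c)))) => //; apply: cell_of.
exists (polyhedron (upd t (Some i) (Some (~~ c)))); split.
  by split=> //; apply: cell_of.
move=> C [/cellP[x cx ->] xb [[u [r [_ PE]]] _]].
have : polyhedron t p by rewrite tE; apply: self_polyhedron.
rewrite PE => -[/incP px _].
have xi := (complementP _).1 cx i.
have xE : sv x = upd t (Some i) (sv x (Some i)).
  apply/ffunP=> -[j|]; last by rewrite sv_None upd_other.
  rewrite updE (inj_eq Some_inj); case: (eqVneq j i) => [->//|ji].
  have := px (Some j) isT; rewrite -tE => -[tj|->//].
  by have := tn (Some j); rewrite tj (inj_eq Some_inj) => /(_ ji).
case E: (sv x (Some i)) xi xE => [c'|//] _ xE; rewrite xE in xb *.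
have [c'c|] := eqVneq c' c; first by rewrite c'c in xb.
by case: c' c {gi unb bnd E xE xb} => [] [].
Qed.

Lemma external_point t : t \in ext -> exists x, t = sv x.
Proof. by rewrite in_set => /andP[/affP[tL to _] _]; apply: cov_point. Qed.

(** Each polyhedron contains a point at which the signs are exactly as recorded. *)
Lemma polyhedron_inj : {in ext &, injective polyhedron}.
Proof.
have half x t : polyhedron (sv x) `<=` polyhedron t ->
    forall k, k != None -> sv x k = None \/ sv x k = t k.
  by move=> xt k ko; have /incP/(_ k ko) := xt _ (self_polyhedron x).
move=> t t' /external_point[x ->] /external_point[y ->] E.
apply/ffunP=> k; have [->|ko] := eqVneq k None; first by rewrite !sv_None.
have [|xk|->//] := half x (sv y) _ k ko; first by rewrite E.
have [|yk|->//] := half y (sv x) _ k ko; first by rewrite E.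
by rewrite xk yk.
Qed.

Lemma polyhedron_convex s x y d : 0 <= d -> d <= 1 -> polyhedron s x ->
  polyhedron s y -> polyhedron s (x + d *: (y - x)).
Proof.
move=> d0 d1 /polyhedronP Px /polyhedronP Py; apply/polyhedronP=> i.
have := Px i; have := Py i; rewrite /weak ell_line; case: (s _) => [c yi xi|->->]; last by ring.
have -> : sg R c * (ell i x + d * (ell i y - ell i x)) =
  (1 - d) * (sg R c * ell i x) + d * (sg R c * ell i y) by ring.
by rewrite addr_ge0 // mulr_ge0 // subr_ge0.
Qed.

(** The planes are left one after the other, by a move towards a point outside the
    next one that is too small to return to the previous ones. *)
Lemma point_off_planes (F : set 'rV[R]_3) : F !=set0 ->
  (forall x y d, 0 <= d -> d <= 1 -> F x -> F y -> F (x + d *: (y - x))) ->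
  exists2 x, F x & forall i y, F y -> ell i y != 0 -> ell i x != 0.
Proof.
move=> [x0 Fx0] cvx.
suff seqs : forall l : seq 'I_n, exists2 x, F x &
    forall i, i \in l -> forall y, F y -> ell i y != 0 -> ell i x != 0.
  by have [x Fx Hx] := seqs (enum 'I_n); exists x => // i; apply: Hx; rewrite mem_enum.
elim => [|i l [x Fx Hx]]; first by exists x0.
have [[y [Fy yi]]|none] := pselect (exists y, F y /\ ell i y != 0); last first.
  exists x => // j; rewrite in_cons => /orP[/eqP->|/Hx//] y Fy yi.
  by case: none; exists y.
have [xi|xi] := eqVneq (ell i x) 0; last first.
  by exists x => // j; rewrite in_cons => /orP[/eqP->|/Hx].
have S : small (fun d => forall j, ell j x != 0 ->
    sgn (ell j x + d * (ell j y - ell j x)) = sgn (ell j x)).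
  apply: small_all => j; have [_|xj] := eqVneq (ell j x) 0; first by exists 1.
  by have [e e0 He] := small_sgn (ell j y - ell j x) xj; exists e => // *; apply: He.
have [d d0 [Hd d1]] := small_witness (small_and S (small_pos ltr01)).
exists (x + d *: (y - x)); first by apply: cvx => //; apply: ltW.
move=> j; rewrite in_cons => /orP[/eqP-> _ _ _|jl z Fz zj].
  by rewrite ell_line xi add0r subr0 mulf_neq0 // gt_eqF.
have xj := Hx j jl z Fz zj.
by rewrite -sgn_None ell_line Hd // sgn_None.
Qed.

(** The signs in [t] are those of a point [x] of the face that lies on as few
    planes as possible. If [y] is a point of that polyhedron, the segment from [y]
    to [x] can be prolonged slightly beyond [x] within the cell; a linear form
    that attains its maximum at [x] is therefore constant on it. *)
Lemma face_polyhedron s F : is_face (polyhedron s) F -> F !=set0 ->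
  exists t, F = polyhedron t.
Proof.
move=> [c [r [valid FE]]] F0.
have cvx x y d : 0 <= d -> d <= 1 -> F x -> F y -> F (x + d *: (y - x)).
  move=> d0 d1; rewrite FE => -[Px /= xr] [Py /= yr]; split.
    exact: polyhedron_convex.
  by rewrite /= dotpD dotpZ dotpD dotpN xr yr subrr mulr0 addr0.
have [x Fx xn] := point_off_planes F0 cvx.
have [Px xr] : (polyhedron s `&` [set y | dotp c y = r]) x by rewrite -FE.
pose t : signvec := [ffun k => if k is Some i then
  if ell i x == 0 then None else s k else None].
have tE i : t (Some i) = if ell i x == 0 then None else s (Some i) by rewrite ffunE.
exists t; apply/seteqP; split=> y.
  move=> Fy; apply/polyhedronP=> i; rewrite tE; case: eqP => [xi|_]; last first.
    by move: Fy; rewrite FE => -[/polyhedronP].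
  by rewrite /weak; apply/eqP; apply: contraTT isT => /(xn i y Fy); rewrite xi eqxx.
move/polyhedronP=> Py.
have Psy : polyhedron s y.
  apply/polyhedronP=> i; have := Py i; rewrite tE; case: eqP => // xi yi.
  by rewrite /weak; case: (s _) => [b'|] //; rewrite yi mulr0.
rewrite FE; split=> //=; apply/eqP; rewrite eq_le valid //=.
have [d d0 Hd] : exists2 d, 0 < d & forall i, ell i x != 0 ->
    sgn (ell i x + d * (ell i x - ell i y)) = sgn (ell i x).
  apply: small_witness; apply: small_all => i.
  have [_|xi] := eqVneq (ell i x) 0; first by exists 1.
  by have [e e0 He] := small_sgn (ell i x - ell i y) xi; exists e => // *; apply: He.
have : dotp c (x - d *: (y - x)) <= r.
  apply: valid; apply/incP=> -[i|//] _; rewrite sv_Some -scaleNr ell_line.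
  have [xi|xi] := eqVneq (ell i x) 0.
    have := Py i; rewrite tE xi eqxx /weak => ->.
    by left; rewrite subrr mulr0 addr0 sgn0.
  have -> : - d * (ell i y - ell i x) = d * (ell i x - ell i y) by ring.
  by rewrite Hd //; move/incP: Px => /(_ (Some i) isT); rewrite sv_Some.
move: xr => /= xr; rewrite dotpD dotpN dotpZ dotpD dotpN xr.
have -> : (r - d * (dotp c y - r) <= r) = (0 <= d * (dotp c y - r)).
  by rewrite gerBl.
by rewrite pmulr_rge0 // subr_ge0.
Qed.

(** Facets are faces of cells, and there are finitely many sign vectors. *)
Lemma finite_external : finite_set (external_facets H).
Proof.
apply: (@sub_finite_set _ _ (range polyhedron)); last exact/finite_image/finite_finset.
move=> F [[C /cellP[x cx ->] [face [[p [_ [Fp _ _ _]]] _]]] _].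
by have [|t ->] := face_polyhedron face; [exists p|exists t].
Qed.

Lemma external_bound :
  (n%:R * (n%:R - 2) + 6) / 3 <= (#|` fset_set (external_facets H)|)%fset%:R :> R.
Proof.
have le_ext : (#|ext| <= #|` fset_set (external_facets H)|)%N.
  have <- : #|` [fset polyhedron t | t in ext]%fset| = #|ext|.
    rewrite card_in_imfset /=; first by rewrite cardE.
    exact: polyhedron_inj.
  apply: fsubset_leq_card; apply/fsubsetP=> _ /imfsetP[t /= te ->].
  rewrite in_fset_set; last exact: finite_external.
  exact/mem_set/external_polyhedron.
have n6 : (6 <= #|{: option 'I_n}|)%N by rewrite card_planes.
have := card_external U n6 None card_planes.
have {}le_ext : (3 * #|ext| <= 3 * #|` fset_set (external_facets H)|)%N by rewrite leq_mul2l.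
move=> /leq_trans/(_ le_ext); rewrite -(ler_nat R) natrD !natrM.
rewrite ler_pdivrMr ?ltr0n // [leRHS]mulrC => bound; apply: le_trans bound; rewrite lerD2r.
have -> : n%:R = n.-1%:R + 1 :> R by rewrite natr1 prednK //; lia.
have : 0 <= n.-1%:R :> R by rewrite ler0n.
nra.
Qed.

End Arrangement.

Local Open Scope classical_set_scope.

Theorem proposition3p1 (R : realType) (n : nat) (H : 'I_n -> set 'rV[R]_3)
    (hn : (5 <= n)%N) (harr : is_arrangement H) (hsimple : is_simple H) :
  finite_set (external_facets H) /\
  (n%:R * (n%:R - 2) + 6) / 3 <= (#|` fset_set (external_facets H)|)%fset%:R :> R.
Proof.
case: harr => plane _.
have /choice[a /choice[b HE]] : forall i, exists a, exists b, H i = [set x | dotp a x = b].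
  by move=> i; have [a [b [_ ->]]] := plane i; exists a, b.
by split; [exact: finite_external HE|exact: external_bound HE hsimple hn].
Qed.
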